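(* Let $n, d \ge 2$ be integers and let $p$ be an odd prime not dividing $d-1$. Define \begin{align*} F_0 &:= p\,x_0^d + 2x_0 x_1 \frac{x_1^{d-1}-x_0^{d-1}}{x_1-x_0}, \\ F_i &:= p\,x_i^d + 2x_1^{d-1} x_i - 2x_0^{d-1} x_{i+1} \qquad (1 \le i \le n), \end{align*} where $x_{n+1} := x_0$. Then $f := [F_0 : \ldots : F_n]$ is a degree-$d$ endomorphism of $\mathbb{P}^n$ (over $\overline{\mathbb{Q}}$) defined over $\mathbb{Q}$ whose critical scheme $C_f$ is an integral hypersurface in $\mathbb{P}^n_{\overline{\mathbb{Q}}}$.
   Context: Here $\frac{x_1^{d-1}-x_0^{d-1}}{x_1-x_0}$ denotes the polynomial $\sum_{k=0}^{d-2} x_0^{k}x_1^{d-2-k}$. The map $f=[F_0:\ldots:F_n]$ is $x\mapsto[F_0(x):\ldots:F_n(x)]$; it is a degree-$d$ endomorphism when the forms $F_i$ of degree $d$ have no common zero in $\mathbb{P}^n(\overline{\mathbb Q})$. Critical scheme: let $f: X \to Y$ be a morphism of nonsingular varieties of the same dimension $r$ over an algebraically closed field. It induces a homomorphism of vector bundles $f^*(T^*Y)\to T^*X$ and, dually, the differential $f': TX \to f^*(TY)$, a homomorphism of rank-$r$ vector bundles on $X$. The critical scheme $C_f$ is the zero scheme of $\det f'$: the closed subscheme of $X$ which on each open set trivializing both bundles is defined by the determinant of a matrix representing $f'$. A hypersurface is a closed subscheme of pure codimension $1$; it is integral iff it is irreducible and reduced (the empty scheme is not integral). *)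

(* Defs.v *)
From HB Require Import structures.
From mathcomp Require Import all_boot all_order all_algebra all_field.
From mathcomp.multinomials Require Export mpoly.

Set Implicit Arguments.
Unset Strict Implicit.
Unset Printing Implicit Defensive.

Import GRing.Theory.
Local Open Scope ring_scope.

(* P^n over an algebraically closed field k is taken as Proj S with
   S = k[x_0, ..., x_n]: its points are the relevant homogeneous primes of S,
   with the Zariski topology.  All its local rings are realized as subrings of
   the fraction field K of S. *)

Section ProjectiveSpace.

Variables (n : nat) (k : closedFieldType).

Local Notation S := {mpoly k[n.+1]}.
Local Notation K := {fraction S}.
Local Notation "g '%:F'" := (FracField.tofrac g : K) (at level 1, format "g %:F").

Definition homog_component (e : nat) (g : S) : S :=
  \sum_(m <- msupp g | mdeg m == e) g@_m *: 'X_[m].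

Record proj_point := ProjPoint {
  prime_of :> S -> Prop;
  prime_of0 : prime_of 0;
  prime_ofD : forall g h, prime_of g -> prime_of h -> prime_of (g + h);
  prime_ofM : forall g h, prime_of h -> prime_of (g * h);
  prime_of_prime : forall g h, prime_of (g * h) -> prime_of g \/ prime_of h;
  prime_of_homog : forall e g, prime_of g -> prime_of (homog_component e g);
  prime_of_relevant : exists i : 'I_n.+1, ~ prime_of 'X_i
}.

Implicit Types (P : proj_point) (Z W A B : proj_point -> Prop).

(** Zariski topology *)

Definition subset_pts Z W := forall P, Z P -> W P.

Definition closed Z :=
  exists E : S -> Prop,
    (forall g, E g -> exists m : nat, g \is m.-homog) /\
    (forall P, Z P <-> forall g, E g -> P g).

Definition irreducible Z :=
  (exists P, Z P) /\
  (forall A B, closed A -> closed B ->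
     (forall P, Z P -> A P \/ B P) -> subset_pts Z A \/ subset_pts Z B).

Definition irreducible_component Z W :=
  [/\ closed W, irreducible W, subset_pts W Z &
      forall W', closed W' -> irreducible W' -> subset_pts W W' -> subset_pts W' Z ->
        subset_pts W' W].

Definition chain_from W (c : nat) (T : nat -> proj_point -> Prop) :=
  [/\ subset_pts W (T 0%N) /\ subset_pts (T 0%N) W,
      forall i, (i <= c)%N -> closed (T i) /\ irreducible (T i) &
      forall i, (i < c)%N -> subset_pts (T i) (T i.+1) /\ ~ subset_pts (T i.+1) (T i)].

(* Codimension in P^n of an irreducible closed W. *)
Definition codim W (c : nat) :=
  (exists T, chain_from W c T) /\ ~ (exists T, chain_from W c.+1 T).

Definition pure_codim Z (c : nat) :=
  forall W, irreducible_component Z W -> codim W c.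

(** Local rings, derivations and the critical scheme *)

(* The local ring of P^n at the homogeneous prime Q: the degree 0 part of S
   localized at the homogeneous elements outside Q. *)
Definition local_ring (Q : S -> Prop) (s : K) :=
  exists (a b : S) (m : nat),
    [/\ a \is m.-homog, b \is m.-homog, ~ Q b & s = a%:F / b%:F].

(* k-linear derivations of the local ring at Q, i.e. the stalk at Q of the
   tangent sheaf; only the values of D on the local ring matter. *)
Definition derivation (Q : S -> Prop) (D : K -> K) :=
  [/\ forall s, local_ring Q s -> local_ring Q (D s),
      forall s t, local_ring Q s -> local_ring Q t -> D (s + t) = D s + D t,
      forall s t, local_ring Q s -> local_ring Q t ->
        D (s * t) = s * D t + t * D s &
      forall c : k, D (c%:MP)%:F = 0].

Definition tangent_frame (Q : S -> Prop) (e : 'I_n -> K -> K) :=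
  (forall i, derivation Q (e i)) /\
  (forall D, derivation Q D ->
     exists! c : 'rV[K]_n,
       (forall i, local_ring Q (c 0 i)) /\
       (forall s, local_ring Q s -> D s = \sum_(i < n) c 0 i * e i s)).

(* f is the rational map [F_0 : ... : F_n]. *)
Variable F : n.+1.-tuple S.

Definition endomorphism (d : nat) :=
  (forall i, tnth F i \is d.-homog) /\
  (forall x : 'I_n.+1 -> k,
     (forall i, (tnth F i).@[x] = 0) -> forall i, x i = 0).

(* The homogeneous prime of the image point f(P). *)
Definition image_point P : S -> Prop := fun g => P (g \mPo F).

(* The graph of the homomorphism f^# from the local ring at f(P) to the local
   ring at P. *)
Definition pullback P (s t : K) :=
  exists (a b : S) (m : nat),
    [/\ a \is m.-homog, b \is m.-homog, ~ image_point P b,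
        s = a%:F / b%:F & t = (a \mPo F)%:F / (b \mPo F)%:F].

(* M represents the differential TX -> f^*(TY) at P in the frame e of TX and
   the pulled back frame f^*(eps) of f^*(TY), that is
     e_i (f^# s) = \sum_j M_ij f^#(eps_j s)   for s in the local ring at f(P). *)
Definition represents_differential P (e eps : 'I_n -> K -> K) (M : 'M[K]_n) :=
  (forall i j, local_ring P (M i j)) /\
  (forall (s t : K) (u : 'I_n -> K),
     pullback P s t -> (forall j, pullback P (eps j s) (u j)) ->
     forall i, e i t = \sum_(j < n) M i j * u j).

(* Stalk at P of the ideal sheaf of the critical scheme C_f: it is generated by
   the determinant of a matrix representing the differential. *)
Definition critical_ideal P (s : K) :=
  exists (e eps : 'I_n -> K -> K) (M : 'M[K]_n) (a : K),
    [/\ tangent_frame P e, tangent_frame (image_point P) eps,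
        represents_differential P e eps M, local_ring P a & s = a * \det M].

(** Closed subschemes of P^n, given by the stalks of their ideal sheaves *)

Implicit Type I : proj_point -> K -> Prop.

(* The stalks I P come from a quasi-coherent sheaf of ideals: near every point
   they are generated by the same finitely many sections. *)
Definition closed_subscheme I :=
  forall P, exists (g : S) (m r : nat) (h : 'I_r -> K),
    [/\ g \is m.-homog, ~ P g &
        forall Q : proj_point, ~ Q g ->
          (forall l, local_ring Q (h l)) /\
          (forall s, I Q s <->
             exists c : 'I_r -> K, (forall l, local_ring Q (c l)) /\
               s = \sum_(l < r) c l * h l)].

Definition subscheme_supp I : proj_point -> Prop := fun P => ~ I P 1.

(* The local rings of the subscheme, local_ring P modulo I P, are reduced. *)
Definition reduced I :=
  forall P, subscheme_supp I P ->
    forall (s : K) (m : nat), local_ring P s -> I P (s ^+ m) -> I P s.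

Definition hypersurface I := closed_subscheme I /\ pure_codim (subscheme_supp I) 1.

Definition integral I := irreducible (subscheme_supp I) /\ reduced I.

End ProjectiveSpace.

(* [F_0 : ... : F_n] is given by forms with rational coefficients, up to a
   common nonzero scalar. *)
Definition defined_over_rat (n : nat) (F : n.+1.-tuple {mpoly algC[n.+1]}) :=
  exists2 c : algC, c != 0 & forall i, c *: tnth F i \is a mpolyOver _ Crat.

(* ordS is the cyclic successor on the indices 0, ..., n, so that x_{n+1}
   is x_0. *)
Definition example_form (n d p : nat) (i : 'I_n.+1) : {mpoly algC[n.+1]} :=
  let x0 : {mpoly algC[n.+1]} := 'X_ord0 in
  let x1 : {mpoly algC[n.+1]} := 'X_(inord 1) in
  if i == ord0 then
    p%:R * x0 ^+ d
      + 2%:R * x0 * x1 * \sum_(0 <= j < d.-1) x0 ^+ j * x1 ^+ (d - 2 - j)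
  else
    p%:R * 'X_i ^+ d + 2%:R * x1 ^+ d.-1 * 'X_i
      - 2%:R * x0 ^+ d.-1 * 'X_(ordS i).

Definition example_map (n d p : nat) : n.+1.-tuple {mpoly algC[n.+1]} :=
  [tuple example_form d p i | i < n.+1].

(* Main.v *)
Require Import Defs.
From HB Require Import structures.
From mathcomp Require Import all_boot all_order all_algebra all_field.
From mathcomp Require classical_sets boolp.
From mathcomp Require Import ring zify.

Set Implicit Arguments.
Unset Strict Implicit.
Unset Printing Implicit Defensive.

Import GRing.Theory.
Local Open Scope ring_scope.

(* Let J be the Jacobian determinant of the forms F_i.  In affine charts of source and target
   the differential of f has determinant (unit) * J / x_i^N, N = (n+1)(d-1), by Euler's relation
   and the chain rule, so C_f is the zero scheme of J and everything reduces to: J is a prime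
   element of the polynomial ring.  Put e = d-1, x = x_0, y = x_1.  Then J/d has integer
   coefficients and its reduction modulo p is, up to a power of 2,
     y G R - G' (y^(ne+1) - x^(ne+1)),  G = (y^e - x^e)/(y - x),  G' = d(yG)/dy,
     R = (e+1) y^(ne) + e sum_(i >= 2) y^((n-i+1)e-1) x^((i-1)e) x_i,
   which is linear in x_n with leading coefficient e x^((n-1)e) y^e G.  It is prime because it is
   congruent to y^N, x^N and -e x^N modulo x, y and G respectively.  Since J is monic in x_1 up to
   units at p, primality lifts along a valuation ring of the algebraic numbers above p.
   That the F_i have no common zero follows in the same way from a valuation ring above 2, modulo
   which F_i is p x_i^d. *)

(** * Places of a field above a prime *)

(** A factorization of J over the algebraic numbers need not have integer coefficients, so reducing
    Z modulo p says nothing about it. Hence a valuation ring of the whole field: in it every nonzero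
    polynomial can be scaled to have a nonzero reduction. Its residue field is known only through
    its characteristic, so the reduction of J is shown to be prime over every field in which e is
    nonzero. There a X + b is prime as soon as a can be cancelled modulo it, with no appeal to
    unique factorization; the three congruences serve to cancel x, y and G. The prime p may divide
    d, and then the Jacobian determinant vanishes modulo p. Therefore it is divided by d over Z, and
    the reduction of J is read off from x J, a determinant whose row 0 holds the forms themselves.
    The hypotheses enter thus: p odd makes 2 a unit modulo p and p a unit modulo 2; p not dividing
    d-1 makes e a unit modulo p; n >= 2 keeps x_n, in which J is linear modulo p, apart from x_1, in
    which J is monic up to a unit. *)

Lemma domain_to_field (D : comNzRingType)
    (integral : forall x y : D, x * y = 0 -> (x == 0) || (y == 0)) :
  exists (L : fieldType) (phi : {rmorphism D -> L}), injective phi.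
Proof.
(* Forming fractions requires a Boolean unit predicate and an inverse function; both come from
   excluded middle and choice. *)
pose u : {pred D} := fun x => boolp.asbool (exists y, y * x = 1).
have exinv (x : D) : exists y, (u x -> y * x = 1) /\ (~~ u x -> y = x).
  case ux: (u x); last by exists x.
  by have [y yx] := boolp.asboolP _ ux; exists y.
pose inv x := projT1 (boolp.cid (exinv x)).
have invP x : (u x -> inv x * x = 1) /\ (~~ u x -> inv x = x).
  exact: projT2 (boolp.cid (exinv x)).
have mulVx : {in u, left_inverse 1 inv *%R} by move=> x ux; case: (invP x) => ->.
have unitP x y : y * x = 1 -> u x by move=> yx; apply/boolp.asboolP; exists y.
have invO : {in [predC u], inv =1 id} by move=> x ux; case: (invP x) => _ ->.
pose UM := GRing.ComNzRing_hasMulInverse.Build D mulVx unitP invO.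
pose U : comUnitRingType := HB.pack D UM.
pose IM := GRing.ComUnitRing_isIntegral.Build U integral.
pose I : idomainType := HB.pack U IM.
exists {fraction I}, (@FracField.tofrac I : {rmorphism I -> {fraction I}}).
by move=> x y /eqP; rewrite tofrac_eq => /eqP.
Qed.

Section PrimeIdeal.

Variables (R : comNzRingType) (P : R -> Prop).

Record prime_ideal : Prop := PrimeIdeal {
  prime_ideal0 : P 0;
  prime_idealD : forall x y, P x -> P y -> P (x + y);
  prime_idealM : forall x y, P y -> P (x * y);
  prime_ideal_prime : forall x y, P (x * y) -> P x \/ P y;
  prime_ideal1 : ~ P 1 }.

(** The field is that of fractions of the quotient by [P]. Membership in a prime ideal thus becomes
    the vanishing of a value in a field, both for valuation rings and for points of the scheme. *)
Lemma prime_ideal_kernel : prime_ideal ->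
  exists (L : fieldType) (phi : {rmorphism R -> L}), forall x, phi x = 0 <-> P x.
Proof.
case=> P0 PD PM PP P1.
pose I : R -> bool := fun x => boolp.asbool (P x).
have IP x : reflect (P x) (x \in I) by exact: boolp.asboolP.
have PN x : P x -> P (- x) by rewrite -mulN1r; apply: PM.
have Iid : idealr_closed I.
  split; first exact/IP.
    by apply/IP.
  by move=> a x y /IP Px /IP Py; apply/IP/PD => //; apply: PM.
have Ipr : prime_idealr_closed I.
  by move=> x y /IP /PP [] H; apply/orP; [left|right]; apply/IP.
pose PIM := isPrimeIdealrClosed.Build R I Ipr.
pose IM := isIdealr.Build R I Iid.
pose PI : prime_idealr R := HB.pack I IM PIM.
have [L [phi phi_inj]] := @domain_to_field {ideal_quot PI} (@Quotient.rquot_IdomainAxiom R PI).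
exists L, (phi \o (\pi_{ideal_quot PI})%qT : {rmorphism R -> L}) => x /=.
have -> : P x <-> x \in PI by split=> /IP.
have piE : x \in PI = (\pi_{ideal_quot PI} x == 0 :> {ideal_quot PI})%qT.
  by rewrite -[x in LHS]subr0 Quotient.idealrBE rmorph0.
rewrite piE; split => [|/eqP ->]; last exact: rmorph0.
by rewrite -(rmorph0 phi) => /phi_inj ->.
Qed.

End PrimeIdeal.

Section SubringType.

Variables (K : fieldType) (S : subringClosed K).

Definition subring_sort := {x : K | x \in S}.

HB.instance Definition _ := SubChoice.on subring_sort.
HB.instance Definition _ := [SubChoice_isSubComNzRing of subring_sort by <:].

End SubringType.

Section Valuation.

Variables (K : fieldType) (p : nat).
Hypotheses (p_gt1 : (1 < p)%N) (char0 : forall m, m.+1%:R != 0 :> K).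

Record subring (A : K -> Prop) : Prop := Subring {
  subring1 : A 1;
  subringB : forall x y, A x -> A y -> A (x - y);
  subringM : forall x y, A x -> A y -> A (x * y) }.

Lemma maximal_subring : exists A : K -> Prop,
  [/\ subring A, ~ A p%:R^-1 &
      forall B, subring B -> (forall x, A x -> B x) -> (exists2 x, B x & ~ A x) ->
        B p%:R^-1].
Proof.
have intA : subring (fun x => exists z : int, x = z%:~R).
  split; first by exists 1.
    by move=> _ _ [z ->] [t ->]; exists (z - t); rewrite rmorphB.
  by move=> _ _ [z ->] [t ->]; exists (z * t); rewrite rmorphM.
have p_neq0 : p%:R != 0 :> K by case: p p_gt1 => [|m] // _; apply: char0.
have intp : ~ exists z : int, p%:R^-1 = z%:~R :> K.
  have E (m : nat) : (p * m)%:R = 1 :> K -> False.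
    case: m => [|m]; first by rewrite muln0 => /eqP; rewrite eq_sym oner_eq0.
    case pm: (p * m.+1)%N => [|[|j]]; first by move/eqP; rewrite eq_sym oner_eq0.
      by move: pm p_gt1 => /eqP; rewrite muln_eq1 => /andP[/eqP-> _].
    move/eqP; rewrite -subr_eq0 mulrSr addrK; exact/negP/char0.
  case=> -[] m /(congr1 (fun x => p%:R * x)); rewrite mulfV //.
    by rewrite -pmulrn -natrM => /esym/E.
  rewrite NegzE mulrNz -pmulrn mulrN -natrM => h.
  have {h}: (p * m.+1).+1%:R = 0 :> K by rewrite mulrSr [X in _ + X]h subrr.
  by apply/eqP/char0.
(* Zorn's lemma also asks about the empty chain, whose union is empty; so the condition binds
   nonempty sets only. A maximal set cannot be empty, since the image of Z would properly contain
   it. *)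
pose Ad (A : K -> Prop) := (exists x, A x) -> subring A /\ ~ A p%:R^-1.
have [|A [AdA maxA]] := @classical_sets.Zorn_bigcup K Ad.
  move=> F FAd Ftot [x [A FA Ax]].
  have sA B y : F B -> B y -> subring B /\ ~ B p%:R^-1.
    by move=> FB By; apply: (FAd _ FB); exists y.
  split; last by case=> B FB Bp; have [_] := sA _ _ FB Bp; apply.
  split; first by exists A => //; have [[]] := sA _ _ FA Ax.
    move=> y z [B FB By] [C FC Cz].
    have [sB _] := sA _ _ FB By; have [sC _] := sA _ _ FC Cz.
    case: (Ftot _ _ FB FC) => sub; [exists C|exists B] => //=.
      exact: (subringB sC (sub _ By) Cz).
    exact: (subringB sB By (sub _ Cz)).
  move=> y z [B FB By] [C FC Cz].
  have [sB _] := sA _ _ FB By; have [sC _] := sA _ _ FC Cz.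
  case: (Ftot _ _ FB FC) => sub; [exists C|exists B] => //=.
    exact: (subringM sC (sub _ By) Cz).
  exact: (subringM sB By (sub _ Cz)).
have maxA' B : subring B -> (forall x, A x -> B x) -> (exists2 x, B x & ~ A x) ->
    B p%:R^-1.
  move=> sB AB [x Bx nAx]; case: (boolp.EM (B p%:R^-1)) => // nBp; exfalso.
  by apply: (maxA B) => //; split => // BA; apply: nAx; apply: BA.
case: (boolp.EM (exists x, A x)) => [exA|A0].
  by have [sA nAp] := AdA exA; exists A.
case: intp; apply: (maxA' _ intA) => [x Ax|]; first by case: A0; exists x.
by exists 1; [exists 1|move=> A1; apply: A0; exists 1].
Qed.

Section MaximalSubring.

Variable A : K -> Prop.
Hypotheses (sA : subring A) (nAp : ~ A p%:R^-1).
Hypothesis maxA : forall B, subring B -> (forall x, A x -> B x) ->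
  (exists2 x, B x & ~ A x) -> B p%:R^-1.

Let A0 : A 0. Proof. by rewrite -(subrr 1); apply: (subringB sA); exact: (subring1 sA). Qed.
Let AN x : A x -> A (- x). Proof. by rewrite -sub0r; apply: (subringB sA). Qed.
Let AD x y : A x -> A y -> A (x + y).
Proof. by move=> Ax Ay; rewrite -[y]opprK; apply: (subringB sA) => //; apply: AN. Qed.
Let An m : A m%:R.
Proof. by elim: m => // m Am; rewrite mulrSr; apply: AD => //; exact: (subring1 sA). Qed.

(** This ideal stands in for the maximal ideal: that it omits 1 is exactly the absence of 1/p from
    [A]. *)
Let pA x := exists2 a, A a & x = p%:R * a.

Let pA0 : pA 0. Proof. by exists 0; rewrite ?mulr0. Qed.
Let pAD x y : pA x -> pA y -> pA (x + y).
Proof. by move=> [a Aa ->] [b Ab ->]; exists (a + b); rewrite ?mulrDr //; apply: AD. Qed.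
Let pAM x y : A x -> pA y -> pA (x * y).
Proof. by move=> Ax [b Ab ->]; exists (x * b); rewrite 1?mulrCA //; apply: (subringM sA). Qed.
Let pAA x : pA x -> A x.
Proof. by case=> a Aa ->; apply: (subringM sA). Qed.

Let p_neq0 : p%:R != 0 :> K. Proof. by case: p p_gt1 => [|m] // _; apply: char0. Qed.

Let pA1 : ~ pA 1.
Proof.
by case=> a Aa /(congr1 ( *%R p%:R^-1)); rewrite mulr1 mulKf // => E; apply: nAp; rewrite E.
Qed.

Let adjoin_subring x :
  subring (fun y => exists2 q : {poly K}, (forall i, A q`_i) & y = q.[x]).
Proof.
split.
- exists 1; last by rewrite hornerC.
  by move=> i; rewrite coef1; apply: An.
- move=> _ _ [q Aq ->] [r Ar ->]; exists (q - r); last by rewrite !hornerE.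
  by move=> i; rewrite coefB; apply: (subringB sA).
- move=> _ _ [q Aq ->] [r Ar ->]; exists (q * r); last by rewrite !hornerE.
  move=> i; rewrite coefM; apply: (big_ind A A0 AD) => j _.
  exact: (subringM sA).
Qed.

(** By maximality A[x] contains 1/p; that expression times p is a relation with coefficients in
    pA. *)
Let adjoin_p x : ~ A x ->
  exists2 q : {poly K}, (forall i, pA q`_i) & q.[x] = 1.
Proof.
move=> nAx.
have [||q Aq qp] := maxA (adjoin_subring x).
- move=> y Ay; exists y%:P; last by rewrite hornerC.
  by move=> i; rewrite coefC; case: ifP.
- exists x => //; exists 'X; last by rewrite hornerX.
  by move=> i; rewrite coefX; apply: An.
exists (p%:R *: q); last by rewrite hornerZ -qp mulfV.
by move=> i; rewrite coefZ; exists q`_i.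
Qed.

(** Let u = 1 - b. If 1/u were outside [A], then 1 = q(1/u) with coefficients in pA; clearing
    denominators puts a power of u into pA, although u is congruent to 1 modulo pA. *)
Let unit_1p b : pA b -> A (1 - b)^-1.
Proof.
move=> pb; apply: boolp.contrapT => nAu.
have [q pq q1] := adjoin_p nAu.
have u0 : 1 - b != 0 by apply/eqP => u0; apply: nAu; rewrite u0 invr0.
pose u := 1 - b; have Au : A u by apply: (subringB sA); [exact: (subring1 sA)|exact: pAA].
have pu m : pA (u ^+ m - 1).
  elim: m => [|m IH]; first by rewrite expr0 subrr.
  have -> : u ^+ m.+1 - 1 = u * (u ^+ m - 1) + (-1) * b by rewrite exprS /u; ring.
  apply: pAD; first exact: pAM.
  by apply: pAM => //; apply: AN; apply: (subring1 sA).
have AX m : A (u ^+ m).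
  by elim: m => [|m IH]; rewrite ?exprS; [exact: (subring1 sA)|exact: (subringM sA)].
have : pA (u ^+ size q * q.[u^-1]).
  rewrite horner_coef mulr_sumr; apply: (big_ind pA pA0 pAD) => j _.
  rewrite mulrCA exprVn -expfB // mulrC; apply: pAM => //.
rewrite q1 mulr1 => H; apply: pA1.
have -> : 1 = u ^+ size q + (-1) * (u ^+ size q - 1) by ring.
by apply: pAD => //; apply: pAM => //; apply: AN; apply: (subring1 sA).
Qed.

(* The shorter of the relations q(x) = 1 and r(1/x) = 1 is solved for the top power and used to
   shorten the other one. *)
Let reduce_degree N x (q r : {poly K}) :
  x != 0 -> (forall i, pA q`_i) -> (forall i, pA r`_i) -> q.[x] = 1 -> r.[x^-1] = 1 ->
  (size q + size r <= N)%N -> False.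
Proof.
elim: N x q r => [|N IH].
  move=> x q r _ _ _ qx _; rewrite leqn0 addn_eq0 size_poly_eq0 => /andP[/eqP q0 _].
  by move/eqP: qx; rewrite q0 horner0 eq_sym oner_eq0.
have step x (q r : {poly K}) : x != 0 -> (forall i, pA q`_i) -> (forall i, pA r`_i) ->
  q.[x] = 1 -> r.[x^-1] = 1 -> (size q + size r <= N.+1)%N -> (size r <= size q)%N -> False.
  move=> x0 pq pr qx rx sN srq.
  case Eq: (size q) => [|n].
    by move/eqP: Eq qx; rewrite size_poly_eq0 => /eqP->;
      rewrite horner0 => /eqP; rewrite eq_sym oner_eq0.
  have r01 : 1 - r`_0 != 0 by rewrite subr_eq0; apply/eqP => E; apply: pA1; rewrite E.
  pose c := (1 - r`_0)^-1; have Ac : A c by apply: unit_1p.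
  (* The relation r(1/x) = 1 times x^n reads x^n = c sum_(i < n) r_(n-i) x^i, because r has size at
     most n+1; this replaces the top term of q. *)
  pose q' := \poly_(i < n) (q`_i + q`_n * c * r`_(n - i)).
  apply: (IH x q' r) => //.
  - move=> i; rewrite coef_poly; case: ifP => // _; apply: pAD => //.
    by apply: pAM => //; apply: (subringM sA) => //; apply: pAA.
  - rewrite (horner_coef_wide _ (size_poly _ _)).
    under eq_bigr => i _ do rewrite coef_poly ltn_ord mulrDl -mulrA.
    rewrite big_split /= -mulr_sumr.
    have -> : \sum_(i < n) r`_(n - i) * x ^+ i = x ^+ n * (1 - r`_0).
      rewrite (reindex_inj rev_ord_inj) -rx.
      have srn : (size r <= n.+1)%N by rewrite -Eq.
      rewrite (horner_coef_wide _ srn) big_ord_recl expr0 mulr1 addrC addKr mulr_sumr.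
      apply: eq_bigr => i _ /=; rewrite subKn // mulrCA; congr (_ * _).
      by rewrite exprVn expfB_cond // (negPf x0) /= ltn_ord.
    have -> : q`_n * c * (x ^+ n * (1 - r`_0)) = q`_n * x ^+ n.
      by rewrite mulrACA [c * _]mulVf // mulr1.
    by rewrite -qx (@horner_coef_wide _ n.+1) ?Eq // big_ord_recr.
  - by rewrite -ltnS (leq_trans _ sN) // Eq -addSn leq_add2r ltnS size_poly.
move=> x q r x0 pq pr qx rx sN.
case: (leqP (size r) (size q)) => [|/ltnW] le; first exact: (step x q r).
by apply: (step x^-1 r q); rewrite ?invr_eq0 ?invrK // addnC.
Qed.

Lemma maximal_subring_valuation x : A x \/ A x^-1.
Proof.
case: (eqVneq x 0) => [->|x0]; first by left; apply: A0.
case: (boolp.EM (A x)) => [|nAx]; [by left|right].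
apply: boolp.contrapT => nAx'.
have [q pq qx] := adjoin_p nAx; have [r pr rx] := adjoin_p nAx'.
exact: (reduce_degree x0 pq pr qx rx (leqnn _)).
Qed.

End MaximalSubring.

(* A is a valuation ring of K above p, and L its residue field (up to extension). *)
Lemma exists_place : exists (A : comNzRingType) (L : fieldType)
    (iota : {rmorphism A -> K}) (res : {rmorphism A -> L}),
  [/\ injective iota, p%:R = 0 :> L,
      forall a, res a != 0 -> exists b, a * b = 1 &
      forall x, exists a, iota a = x \/ iota a = x^-1].
Proof.
have [A [sA nAp maxA]] := maximal_subring.
have val_A := maximal_subring_valuation sA nAp maxA.
have A0 : A 0 by rewrite -(subrr 1); apply: (subringB sA); exact: (subring1 sA).
pose S : {pred K} := fun x => boolp.asbool (A x).
have SP x : reflect (A x) (x \in S) by exact: boolp.asboolP.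
have S_closed : subring_closed S.
  split; first exact/SP/(subring1 sA).
    by move=> x y /SP Ax /SP Ay; apply/SP/(subringB sA).
  by move=> x y /SP Ax /SP Ay; apply/SP/(subringM sA).
pose SM := GRing.isSubringClosed.Build K S S_closed.
pose SR : subringClosed K := HB.pack S SM.
pose T : comNzRingType := subring_sort SR.
pose iota : {rmorphism T -> K} := (val : subring_sort SR -> K).
have iotaA (a : T) : A (iota a) by apply/SP/(valP a).
have AT x : A x -> exists a, iota a = x.
  by move=> /SP Sx; exists (exist _ x Sx).
have iota_inj : injective iota by apply: val_inj.
pose m (a : T) := ~ exists b, a * b = 1.
have unitM a b : m b -> m (a * b).
  by move=> mb [c abc]; apply: mb; exists (a * c); rewrite mulrCA mulrA.
have m_prime : prime_ideal m.
  split.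
  - by case=> b; rewrite mul0r => /eqP; rewrite eq_sym oner_eq0.
  - move=> a b ma mb.
    have [->|a0] := eqVneq a 0; first by rewrite add0r.
    have [->|b0] := eqVneq b 0; first by rewrite addr0.
    (* In a valuation ring one of two elements divides the other, so a sum of nonunits is a multiple
       of a nonunit. *)
    have [c] : exists c, a = c * b \/ b = c * a.
      have ia0 : iota a != 0 by rewrite -(rmorph0 iota) (inj_eq iota_inj).
      have ib0 : iota b != 0 by rewrite -(rmorph0 iota) (inj_eq iota_inj).
      case: (val_A (iota a / iota b)) => /AT[c Ec]; exists c; [left|right];
        by apply: iota_inj; rewrite rmorphM Ec ?invf_div divfK.
    by case=> ->; [rewrite -[X in _ + X]mul1r|rewrite -[X in X + _]mul1r];
      rewrite -mulrDl; apply: unitM.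
  - exact: unitM.
  - move=> a b mab; case: (boolp.EM (m a)) => [|na]; [by left|right].
    case=> c bc; apply: na => -[d ad]; apply: mab; exists (c * d).
    by rewrite -mulrA (mulrA b) bc mul1r.
  - by apply; exists 1; rewrite mulr1.
have [L [res resP]] := prime_ideal_kernel m_prime.
exists T, L, iota, res; split=> //.
- rewrite -(rmorph_nat res); apply/resP => -[b] /(congr1 iota).
  rewrite rmorphM rmorph_nat rmorph1 => E; apply: nAp.
  have -> : p%:R^-1 = iota b.
    have p_neq0 : p%:R != 0 :> K by case: p p_gt1 => [|k] // _; apply: char0.
    by apply: (mulfI p_neq0); rewrite E mulfV.
  exact: iotaA.
- move=> a ra; apply: boolp.contrapT => /resP ra0.
  by rewrite ra0 eqxx in ra.
- by move=> x; case: (val_A x) => /AT[a <-]; exists a; [left|right].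
Qed.

End Valuation.

(** * Polynomials as univariate polynomials in one of the variables *)

Definition divides (R : comNzRingType) (g a : R) := exists q, a = q * g.

(** In a domain 0 and the units also satisfy this; they are excluded separately, by [J != 0] and by
    a degree above 1. *)
Definition prime_element (R : comNzRingType) (g : R) :=
  forall a b, divides g (a * b) -> divides g a \/ divides g b.

Lemma mpoly_rmorph_ext (R : comNzRingType) (T : comNzRingType) n
    (f g : {rmorphism {mpoly R[n]} -> T}) :
  (forall c, f c%:MP = g c%:MP) -> (forall i, f 'X_i = g 'X_i) -> f =1 g.
Proof.
move=> fgC fgX q; rewrite (mpolyE q) !rmorph_sum; apply: eq_bigr => m _.
rewrite -mul_mpolyC !rmorphM fgC; congr (_ * _).
rewrite mpolyXE_id !rmorph_prod; apply: eq_bigr => i _.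
by rewrite !rmorphXn fgX.
Qed.

Lemma poly_rmorph_ext (R : nzRingType) (T : comNzRingType)
    (f g : {rmorphism {poly R} -> T}) :
  (forall c, f c%:P = g c%:P) -> f 'X = g 'X -> f =1 g.
Proof.
move=> fgC fgX q; rewrite -(coefK q) poly_def !rmorph_sum; apply: eq_bigr => i _.
by rewrite -mul_polyC !rmorphM fgC !rmorphXn fgX.
Qed.

Section SplitVariable.

Variables (n : nat) (i : 'I_n.+1).

Section Ring.

Variable R : comNzRingType.

Definition split_image (j : 'I_n.+1) : {poly {mpoly R[n]}} :=
  if unlift i j is Some k then ('X_k)%:P else 'X.

Fact split_var_key : unit. Proof. by []. Qed.

(* Locked: unification would otherwise unfold it into sums over supports. *)
Definition split_var : {mpoly R[n.+1]} -> {poly {mpoly R[n]}} :=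
  locked_with split_var_key (mmap (polyC \o @mpolyC n R) split_image).

Fact split_var_is_zmod_morphism : zmod_morphism split_var.
Proof. by rewrite /split_var unlock; exact: raddfB. Qed.

Fact split_var_is_monoid_morphism : monoid_morphism split_var.
Proof. by rewrite /split_var unlock; split=> [|g h]; rewrite (rmorph1, rmorphM). Qed.

HB.instance Definition _ :=
  GRing.isZmodMorphism.Build _ _ split_var split_var_is_zmod_morphism.
HB.instance Definition _ :=
  GRing.isMonoidMorphism.Build _ _ split_var split_var_is_monoid_morphism.

Lemma split_varC c : split_var c%:MP = c%:MP%:P.
Proof. by rewrite /split_var unlock mmapC. Qed.

Lemma split_varX : split_var 'X_i = 'X.
Proof. by rewrite /split_var unlock mmapX mmap1U /split_image unlift_none. Qed.

Lemma split_var_lift k : split_var 'X_(lift i k) = ('X_k)%:P.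
Proof. by rewrite /split_var unlock mmapX mmap1U /split_image liftK. Qed.

Definition widen_var : {mpoly R[n]} -> {mpoly R[n.+1]} :=
  mmap (@mpolyC n.+1 R) (fun k => 'X_(lift i k)).

HB.instance Definition _ := GRing.RMorphism.copy widen_var
  (mmap (@mpolyC n.+1 R) (fun k => 'X_(lift i k))).

Definition join_var : {poly {mpoly R[n]}} -> {mpoly R[n.+1]} :=
  horner_eval 'X_i \o map_poly widen_var.

HB.instance Definition _ := GRing.RMorphism.copy join_var
  (horner_eval 'X_i \o map_poly widen_var).

Lemma widen_varC c : widen_var c%:MP = c%:MP.
Proof. exact: mmapC. Qed.

Lemma widen_varX k : widen_var 'X_k = 'X_(lift i k).
Proof. by rewrite /widen_var mmapX mmap1U. Qed.

Lemma join_varC c : join_var c%:P = widen_var c.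
Proof. by rewrite /join_var /= map_polyC /horner_eval hornerC. Qed.

Lemma join_varX : join_var 'X = 'X_i.
Proof. by rewrite /join_var /= map_polyX /horner_eval hornerX. Qed.

Lemma split_varK : cancel split_var join_var.
Proof.
apply: (@mpoly_rmorph_ext _ _ _ (join_var \o split_var : {rmorphism _ -> _}) idfun) => [c|j] /=.
  by rewrite split_varC join_varC widen_varC.
case: (unliftP i j) => [k|] ->; last by rewrite split_varX join_varX.
by rewrite split_var_lift join_varC widen_varX.
Qed.

Lemma join_varK : cancel join_var split_var.
Proof.
apply: (@poly_rmorph_ext _ _ (split_var \o join_var : {rmorphism _ -> _}) idfun) => [c|] /=.
  rewrite join_varC.
  apply: (@mpoly_rmorph_ext _ _ _ (split_var \o widen_var : {rmorphism _ -> _}) polyC) => [a|k] /=.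
    by rewrite widen_varC split_varC.
  by rewrite widen_varX split_var_lift.
by rewrite join_varX split_varX.
Qed.

Lemma split_var_inj : injective split_var.
Proof. exact: can_inj split_varK. Qed.

Lemma split_var_eq0 g : (split_var g == 0) = (g == 0).
Proof. by rewrite -(inj_eq split_var_inj) rmorph0. Qed.

Lemma divides_split_var g a : divides (split_var g) (split_var a) <-> divides g a.
Proof.
split=> -[q E]; last by exists (split_var q); rewrite E rmorphM.
by exists (join_var q); apply: split_var_inj; rewrite rmorphM /= join_varK.
Qed.

Definition mnm_skip (m : 'X_{1..n.+1}) : 'X_{1..n} := [multinom m (lift i k) | k < n].

Lemma split_var_monomial m : split_var 'X_[m] = ('X_[mnm_skip m])%:P * 'X^(m i).
Proof.
rewrite !mpolyXE_id rmorph_prod (bigD1_ord i) //= rmorphXn /= split_varX mulrC.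
congr (_ * _); rewrite rmorph_prod; apply: eq_bigr => k _.
by rewrite !rmorphXn /= split_var_lift mnmE.
Qed.

Lemma mdeg_skip m : mdeg m = (m i + mdeg (mnm_skip m))%N.
Proof.
rewrite !mdegE (bigD1_ord i) //=; congr (_ + _)%N.
by apply: eq_bigr => k _; rewrite mnmE.
Qed.

Lemma coef_split_var g j :
  (split_var g)`_j = \sum_(m <- msupp g | m i == j) g@_m *: 'X_[mnm_skip m].
Proof.
rewrite {1}(mpolyE g) rmorph_sum coef_sum [RHS]big_mkcond; apply: eq_bigr => m _.
rewrite -mul_mpolyC rmorphM /= split_varC split_var_monomial mulrA -polyCM mul_mpolyC.
by rewrite coefCM coefXn eq_sym; case: eqP; rewrite (mulr1, mulr0).
Qed.

Lemma size_split_var_homog d g : g \is d.-homog -> (size (split_var g) <= d.+1)%N.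
Proof.
move=> gdh; have gd m : m \in msupp g -> mdeg m = d by exact: (dhomog_mf gdh).
apply/leq_sizeP => j dj; rewrite coef_split_var big_seq_cond big1 // => m.
case/andP=> /gd md /eqP mj.
by move: dj; rewrite -md mdeg_skip mj ltnNge leq_addr.
Qed.

Lemma coef_split_var_homog d g : g \is d.-homog ->
  (split_var g)`_d = (g@_(U_(i) *+ d)%MM)%:MP.
Proof.
move=> gdh; have gd m : m \in msupp g -> mdeg m = d by exact: (dhomog_mf gdh).
rewrite coef_split_var.
have top m : m \in msupp g -> m i = d -> m = (U_(i) *+ d)%MM.
  move=> /gd + E; rewrite mdeg_skip E => /eqP.
  rewrite -[X in _ == X]addn0 eqn_add2l mdeg_eq0 => /eqP m0.
  apply/mnmP => k; rewrite mulmnE mnm1E; case: (unliftP i k) => [k'|] ->.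
    by move/mnmP: m0 => /(_ k'); rewrite mnmE mnm0E (negPf (neq_lift _ _)).
  by rewrite eqxx mul1n.
have skip0 : mnm_skip (U_(i) *+ d)%MM = 0%MM.
  by apply/mnmP => k; rewrite mnmE mulmnE mnm1E mnm0E (negPf (neq_lift _ _)).
rewrite big_mkcond /=.
have [dg|dg] := boolP ((U_(i) *+ d)%MM \in msupp g).
  rewrite (bigD1_seq (U_(i) *+ d)%MM) ?msupp_uniq //= mulmnE mnm1E eqxx mul1n eqxx.
  rewrite skip0 mpolyX0 big_seq_cond big1 ?addr0 => [|m /andP[gm mU]].
    by rewrite -mul_mpolyC mulr1.
  by case: eqP => // /(top _ gm) E; rewrite E eqxx in mU.
rewrite (memN_msupp_eq0 dg) mpolyC0 big_seq_cond big1 // => m /andP[gm _].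
by case: eqP => // /(top _ gm) E; rewrite E (negPf dg) in gm.
Qed.

(** At the i-th coordinate point only the pure power of x_i survives. The leading coefficient in x_i
    can thus be computed by an evaluation. *)
Lemma meval_homog_delta d (g : {mpoly R[n.+1]}) : g \is d.-homog ->
  g.@[fun j => (j == i)%:R] = g@_(U_(i) *+ d)%MM.
Proof.
move=> gd; have /(congr1 (fun q : {mpoly R[n]} => q@_0%MM)) := coef_split_var_homog gd.
rewrite mcoeffC eqxx mulr1 => <-; rewrite coef_split_var mevalE rmorph_sum /=.
have {}gd m : m \in msupp g -> mdeg m = d by exact: (dhomog_mf gd).
rewrite [RHS]big_mkcond !(big_seq_cond xpredT).
apply: eq_bigr => m /andP[/gd md _].
rewrite mcoeffZ mcoeffX (bigD1_ord i) //= eqxx expr1n mul1r.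
have -> : (m i == d) = (mnm_skip m == 0%MM).
  by rewrite -mdeg_eq0 -md mdeg_skip -[X in X == _]addn0 eqn_add2l eq_sym.
case: eqP => [/mnmP m0|/eqP m0].
  rewrite big1 // => k _.
  by move: (m0 k); rewrite mnmE mnm0E => ->.
have [k mk] : exists k, m (lift i k) != 0%N.
  apply/existsP; apply: contra_neqT m0 => /existsPn m0; apply/mnmP => k.
  by rewrite mnmE mnm0E; apply/eqP/negbNE/m0.
rewrite (bigD1 k) //= eq_sym (negPf (neq_lift _ _)) expr0n (negPf mk).
by rewrite mul0r mulr0.
Qed.

End Ring.

Lemma size_split_varZ (R : idomainType) c (g : {mpoly R[n.+1]}) :
  c != 0 -> size (split_var (c *: g)) = size (split_var g).
Proof.
by move=> c0; rewrite -mul_mpolyC rmorphM /= split_varC size_Cmul // mpolyC_eq0.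
Qed.

Lemma split_var_map (R T : comNzRingType) (f : {rmorphism R -> T}) g :
  split_var (map_mpoly f g) = map_poly (map_mpoly f) (split_var g).
Proof.
apply: (@mpoly_rmorph_ext _ _ _ (@split_var T \o map_mpoly f : {rmorphism _ -> _})
  (map_poly (map_mpoly f) \o @split_var R : {rmorphism _ -> _})) => [c|j] /=.
  by rewrite map_mpolyC !split_varC map_polyC /= map_mpolyC.
rewrite map_mpolyX; case: (unliftP i j) => [k|] ->.
  by rewrite !split_var_lift map_polyC /= map_mpolyX.
by rewrite !split_varX map_polyX.
Qed.

End SplitVariable.

(** * Lifting primality from a residue field *)

Lemma coef_neq0_size (R : nzRingType) (q : {poly R}) i : q`_i != 0 -> (i < size q)%N.
Proof. by rewrite ltnNge; apply: contraNN => /(nth_default 0) ->. Qed.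

Lemma size_mul_gt (R : idomainType) (u v : {poly R}) N :
  u != 0 -> size v = N.+1 -> (N < size (u * v)%R)%N.
Proof.
move=> u0 sv; have v0 : v != 0 by rewrite -size_poly_eq0 sv.
rewrite size_mul // sv addnS /= -[X in (X < _)%N]add0n ltn_add2r.
by rewrite size_poly_gt0.
Qed.

Section LiftPrime.

Variables (K L : fieldType) (A : comNzRingType).
Variables (iota : {rmorphism A -> K}) (res : {rmorphism A -> L}).
Hypothesis iota_inj : injective iota.
Hypothesis res_unit : forall a, res a != 0 -> exists b, a * b = 1.
Hypothesis valuation : forall x, exists a, iota a = x \/ iota a = x^-1.

(** Among finitely many elements one divides all the others with respect to the valuation; [c] is
    its inverse. When [c * x] is not in the ring, its inverse is, and x takes over as the common
    divisor. *)
Lemma primitive_scaling (s : seq K) : has (predC1 0) s ->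
  exists2 c, c != 0 & (forall x, x \in s -> exists a, iota a = c * x) /\ 1 \in map ( *%R c) s.
Proof.
elim: s => [//|x s IH] /=; have [/IH[c c0 [cA c1]] _|/hasPn s0] := boolP (has _ s).
  have [a [Ea|Ea]] := valuation (c * x).
    exists c => //; split; last by rewrite inE c1 orbT.
    by move=> y; rewrite inE => /predU1P[->|/cA //]; exists a.
  have [cx0|cx0] := eqVneq (c * x) 0.
    exists c => //; split; last by rewrite inE c1 orbT.
    by move=> y; rewrite inE => /predU1P[->|/cA //]; exists 0; rewrite rmorph0 cx0.
  have x0 : x != 0 by apply: contraNneq cx0 => ->; rewrite mulr0.
  exists x^-1; rewrite ?invr_eq0 //; split; last by rewrite inE mulVf ?eqxx.
  move=> y; rewrite inE => /predU1P[->|/cA[b Eb]]; first by exists 1; rewrite rmorph1 mulVf.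
  exists (a * b); by rewrite rmorphM Ea Eb; field; rewrite x0 c0.
rewrite orbF => x0; exists x^-1; rewrite ?invr_eq0 //.
split; last by rewrite inE mulVf ?eqxx.
move=> y; rewrite inE => /predU1P[->|/s0]; first by exists 1; rewrite rmorph1 mulVf.
by rewrite /= negbK => /eqP->; exists 0; rewrite mulr0 rmorph0.
Qed.

(** The substitute for dividing by the content: some coefficient becomes 1, so the reduction cannot
    vanish. *)
Lemma primitive_multiple n (g : {mpoly K[n]}) : g != 0 ->
  exists2 c, c != 0 & exists2 h : {mpoly A[n]},
    map_mpoly iota h = c *: g & map_mpoly res h != 0.
Proof.
move=> g0; have [|c c0 [cA /mapP[x /mapP[m0 m0g ->] c1]]] :=
    @primitive_scaling [seq g@_m | m <- msupp g].
  apply/hasP; exists (mleadc g); first by apply/mapP; exists (mlead g); rewrite ?mlead_supp.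
  by rewrite /= mleadc_eq0.
exists c => //.
have [h Eh] : exists h : {mpoly A[n]},
    map_mpoly iota h = \sum_(m <- msupp g) (c * g@_m) *: 'X_[m].
  elim: (msupp g) (cA) => [_|m s IH sA]; first by exists 0; rewrite rmorph0 big_nil.
  have [|h Eh] := IH; first by move=> y ys; apply: sA; rewrite inE ys orbT.
  have [|a Ea] := sA (g@_m); first by rewrite inE eqxx.
  exists (a *: 'X_[m] + h).
  by rewrite big_cons rmorphD /= Eh map_mpolyZ map_mpolyX Ea.
have {}Eh : map_mpoly iota h = c *: g.
  by rewrite Eh {3}(mpolyE g) scaler_sumr; apply: eq_bigr => m _; rewrite scalerA.
exists h => //; apply/eqP => /(congr1 (fun q : {mpoly L[n]} => q@_m0)).
rewrite mcoeff_map_mpoly mcoeff0 /= => hm0.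
have : iota h@_m0 = 1 by rewrite -(mcoeff_map_mpoly iota) Eh mcoeffZ -c1.
by rewrite -(rmorph1 iota) => /iota_inj E; move/eqP: hm0; rewrite E rmorph1 oner_eq0.
Qed.

Lemma map_mpoly_inj n (R T : comNzRingType) (f : {rmorphism R -> T}) :
  injective f -> injective (map_mpoly f : {mpoly R[n]} -> {mpoly T[n]}).
Proof.
move=> f_inj g h E; apply/mpolyP => m; apply: f_inj.
by rewrite -!mcoeff_map_mpoly E.
Qed.

Variables (n N : nat) (i : 'I_n.+1) (J : {mpoly A[n.+1]}).
Hypothesis J_homog : J \is N.-homog.
Hypothesis J_top : res J@_(U_(i) *+ N)%MM != 0.

Let JK := map_mpoly iota J.
Let JL := map_mpoly res J.

Let map_homog (R : nzRingType) (f : {rmorphism A -> R}) : map_mpoly f J \is N.-homog.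
Proof.
apply/dhomogP => m; rewrite mcoeff_msupp mcoeff_map_mpoly => Jm.
apply: (dhomog_mf J_homog); rewrite mcoeff_msupp.
by apply: contraNneq Jm => ->; rewrite raddf0.
Qed.

Let iota_neq0 a : res a != 0 -> iota a != 0.
Proof.
by apply: contraNneq; rewrite -(rmorph0 iota) => /iota_inj ->; rewrite rmorph0.
Qed.

(* J is monic in the variable i up to a unit, so every class modulo J has a representative of
   degree < N in this variable. *)
Let reduced_rep (g : {mpoly K[n.+1]}) :
  exists q r, g = q * JK + r /\ (size (split_var i r) <= N)%N.
Proof.
pose c := JK@_(U_(i) *+ N)%MM.
have c0 : c != 0 by rewrite /c mcoeff_map_mpoly iota_neq0.
pose M := c^-1 *: JK; pose m := split_var i M.
have M_homog : M \is N.-homog by apply/dhomogZ/map_homog.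
have mN : m`_N = 1 by rewrite coef_split_var_homog // mcoeffZ mulVf.
have size_m : size m = N.+1.
  apply/eqP; rewrite eqn_leq size_split_var_homog //=.
  by apply: coef_neq0_size; rewrite mN oner_neq0.
have m_monic : m \is monic by rewrite monicE /lead_coef size_m mN.
exists (c^-1 *: join_var i (Pdiv.Ring.rdivp (split_var i g) m)).
exists (join_var i (Pdiv.Ring.rmodp (split_var i g) m)); split; last first.
  by rewrite join_varK -ltnS -size_m Pdiv.Ring.ltn_rmodp monic_neq0.
apply: (split_var_inj (i := i)); rewrite -scalerAl scalerAr rmorphD rmorphM /=.
by rewrite !join_varK -Pdiv.RingMonic.rdivp_eq.
Qed.

Let JL_neq0 : JL != 0.
Proof. by apply: contraNneq J_top; rewrite -mcoeff_map_mpoly -/JL => ->; rewrite mcoeff0. Qed.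

Let size_JL : size (split_var i JL) = N.+1.
Proof.
have JLN : (split_var i JL)`_N != 0.
  by rewrite coef_split_var_homog ?map_homog // mpolyC_eq0 mcoeff_map_mpoly.
by apply/eqP; rewrite eqn_leq (coef_neq0_size JLN) andbT size_split_var_homog ?map_homog.
Qed.

(** Reduction does not raise the degree in the variable [i], and a nonzero multiple of [JL] has
    degree at least N in it. *)
Let not_divides_reduced (h : {mpoly A[n.+1]}) :
  (size (split_var i (map_mpoly iota h)) <= N)%N -> map_mpoly res h != 0 ->
  ~ divides JL (map_mpoly res h).
Proof.
move=> sh h0 [q E].
have sh' : (size (split_var i (map_mpoly res h)) <= N)%N.
  apply: leq_trans sh; rewrite !split_var_map.
  rewrite [leqRHS]size_map_inj_poly ?rmorph0 //; last exact: map_mpoly_inj.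
  exact: size_poly.
have q0 : q != 0 by apply: contraNneq h0; rewrite E => ->; rewrite mul0r.
have := size_mul_gt (u := split_var i q) (v := split_var i JL) _ size_JL.
rewrite split_var_eq0 => /(_ q0); rewrite ltnNge => /negP; apply.
by move: sh'; rewrite E rmorphM.
Qed.

(** Gauss's argument. Both factors are replaced by representatives of degree below N, then these and
    the cofactor are scaled to primitive polynomials. Reducing the resulting identity makes [JL]
    divide the product of the two reductions, hence one of them, against [not_divides_reduced]. *)
Lemma lift_prime_element : prime_element JL -> prime_element JK.
Proof.
move=> primeJ g h [q E].
have [qg [rg [Eg sg]]] := reduced_rep g; have [qh [rh [Eh sh]]] := reduced_rep h.
have [rg0|rg0] := eqVneq rg 0; first by left; exists qg; rewrite Eg rg0 addr0.
have [rh0|rh0] := eqVneq rh 0; first by right; exists qh; rewrite Eh rh0 addr0.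
exfalso.
have [cg cg0 [g' Eg' g'0]] := primitive_multiple rg0.
have [ch ch0 [h' Eh' h'0]] := primitive_multiple rh0.
pose q1 := q - qg * h - rg * qh.
have Eq1 : rg * rh = q1 * JK.
  by move: E; rewrite /q1 {1}Eg Eh => E; rewrite !mulrBl -E; ring.
have q10 : q1 != 0.
  by apply/eqP => q0; move/eqP: Eq1; rewrite q0 mul0r mulf_eq0 (negPf rg0) (negPf rh0).
have [cq cq0 [q' Eq' q'0]] := primitive_multiple q10.
have sg' : (size (split_var i (map_mpoly iota g')) <= N)%N.
  by rewrite Eg' size_split_varZ.
have sh' : (size (split_var i (map_mpoly iota h')) <= N)%N.
  by rewrite Eh' size_split_varZ.
have Egh : cq *: map_mpoly iota (g' * h') = (cg * ch) *: map_mpoly iota (q' * J).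
  rewrite !rmorphM /= Eg' Eh' Eq' -/JK -!scalerAl -!scalerAr -Eq1 !scalerA.
  by congr (_ *: _); ring.
have : divides JL (map_mpoly res g' * map_mpoly res h').
  have [a [Ea|Ea]] := valuation (cq / (cg * ch)).
    have {}Egh : a *: (g' * h') = q' * J.
      apply: (map_mpoly_inj iota_inj); rewrite map_mpolyZ Ea [cq / _]mulrC -scalerA Egh scalerA.
      by rewrite mulVf ?scale1r // mulf_neq0.
    have EghL := congr1 (map_mpoly res) Egh.
    (* The right-hand side has a nonzero reduction, since both [q'] and [J] do; so the scalar on the
       left is a unit. *)
    have /res_unit[b ab] : res a != 0.
      apply/eqP => a0; move/eqP: EghL; rewrite map_mpolyZ a0 scale0r eq_sym rmorphM /= mulf_eq0.
      by rewrite (negPf q'0) (negPf JL_neq0).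
    exists (map_mpoly res (b *: q')); rewrite -!rmorphM /=; congr (map_mpoly res _).
    by rewrite -scalerAl -Egh scalerA (mulrC b) ab scale1r.
  exists (map_mpoly res (a *: q')); rewrite -!rmorphM /=; congr (map_mpoly res _).
  apply: (map_mpoly_inj iota_inj); rewrite -scalerAl map_mpolyZ Ea invf_div.
  by rewrite [_ / cq]mulrC -scalerA -Egh scalerA mulVf ?scale1r.
by case/primeJ; apply: not_divides_reduced.
Qed.

End LiftPrime.

(** * Primality of polynomials linear in one variable *)

Lemma divides_mull (R : comNzRingType) (g a b : R) : divides g a -> divides g (b * a).
Proof. by case=> q ->; exists (b * q); rewrite mulrA. Qed.

Lemma dividesD (R : comNzRingType) (g a b : R) :
  divides g a -> divides g b -> divides g (a + b).
Proof. by move=> [q ->] [r ->]; exists (q + r); rewrite mulrDl. Qed.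

Lemma dividesN (R : comNzRingType) (g a : R) : divides g a -> divides g (- a).
Proof. by move=> [q ->]; exists (- q); rewrite mulNr. Qed.

(** Pseudo-division by P makes each factor, times a power of a, congruent to a constant. The product
    of the two constants is a multiple of a polynomial of degree 1, so one of them is 0, and the
    power of a is cancelled by hypothesis. *)
Lemma linear_poly_prime (D : idomainType) (a b : D) : a != 0 ->
  (forall u, divides (a *: 'X + b%:P) (a *: u) -> divides (a *: 'X + b%:P) u) ->
  prime_element (a *: 'X + b%:P).
Proof.
move=> a0; set P := _ + _ => cancel_a g h Pgh.
have sP : size P = 2 by rewrite /P -mul_polyC size_MXaddC polyC_eq0 (negPf a0) /= size_polyC a0.
have leadP : lead_coef P = a.
  by rewrite /lead_coef sP /P coefD coefZ coefX coefC mulr1 addr0.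
have cancel_aX k u : divides P (a ^+ k *: u) -> divides P u.
  elim: k u => [|k IH] u; first by rewrite expr0 scale1r.
  by rewrite exprSr -scalerA => /IH/cancel_a.
have div u : exists k q c, a ^+ k *: u = q * P + c%:P.
  exists (Pdiv.Ring.rscalp u P), (Pdiv.Ring.rdivp u P), (Pdiv.Ring.rmodp u P)`_0.
  rewrite -leadP Pdiv.ComRing.rdivp_eq; congr (_ + _); apply: size1_polyC.
  by have := Pdiv.Ring.ltn_rmodp u P; rewrite sP ltnS => ->; rewrite -size_poly_eq0 sP.
have [k [q [c Eg]]] := div g; have [l [r [d Eh]]] := div h.
have : divides P (c * d)%:P.
  have -> : (c * d)%:P = (a ^+ (k + l)) *: (g * h) + - ((q * (r * P + d%:P) + r * c%:P) * P).
    rewrite exprD -scalerA scalerAr scalerAl Eg Eh polyCM; ring.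
  apply: dividesD; first by rewrite -mul_polyC; apply: divides_mull.
  by apply: dividesN; exists (q * (r * P + d%:P) + r * c%:P).
case=> s Es; have [s0|s0] := eqVneq s 0; last first.
  have := size_mul_gt s0 sP; by rewrite -Es ltnNge size_polyC_leq1.
move/eqP: Es; rewrite s0 mul0r polyC_eq0 mulf_eq0 => /orP[]/eqP z.
  by left; apply: (cancel_aX k); exists q; rewrite Eg z addr0.
by right; apply: (cancel_aX l); exists r; rewrite Eh z addr0.
Qed.

Lemma linear_mpoly_prime (L : idomainType) n (i : 'I_n.+1) (a b : {mpoly L[n]})
    (P := widen_var i a * 'X_i + widen_var i b) : a != 0 ->
  (forall u, divides P (widen_var i a * u) -> divides P u) -> prime_element P.
Proof.
have split_widen c : split_var i (widen_var i c) = c%:P.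
  by rewrite -join_varC join_varK.
have EP : split_var i P = a *: 'X + b%:P.
  by rewrite /P rmorphD rmorphM /= !split_widen split_varX mul_polyC.
move=> a0 cancel_a g h; rewrite -!(divides_split_var i) rmorphM /= EP.
apply: linear_poly_prime a0 _ _ _ => u.
rewrite -EP -[u](join_varK i) -mul_polyC -split_widen -rmorphM !divides_split_var.
exact: cancel_a.
Qed.

Section KillVariable.

Variables (L : comNzRingType) (n : nat) (i : 'I_n.+1).

Fact kill_var_key : unit. Proof. by []. Qed.

(** Reduction modulo x_i, realized as an endomorphism of the polynomial ring so that congruences
    become equations in the same ring. *)
Definition kill_var : {mpoly L[n.+1]} -> {mpoly L[n.+1]} :=
  locked_with kill_var_key
    (mmap (@mpolyC n.+1 L) (fun j => if j == i then 0 else 'X_j)).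

Fact kill_var_is_zmod_morphism : zmod_morphism kill_var.
Proof. by rewrite /kill_var unlock; exact: raddfB. Qed.

Fact kill_var_is_monoid_morphism : monoid_morphism kill_var.
Proof. by rewrite /kill_var unlock; split=> [|g h]; rewrite (rmorph1, rmorphM). Qed.

HB.instance Definition _ :=
  GRing.isZmodMorphism.Build _ _ kill_var kill_var_is_zmod_morphism.
HB.instance Definition _ :=
  GRing.isMonoidMorphism.Build _ _ kill_var kill_var_is_monoid_morphism.

Lemma kill_varC c : kill_var c%:MP = c%:MP.
Proof. by rewrite /kill_var unlock mmapC. Qed.

Lemma kill_varX j : kill_var 'X_j = if j == i then 0 else 'X_j.
Proof. by rewrite /kill_var unlock mmapX mmap1U. Qed.

Lemma kill_varP g : divides 'X_i (g - kill_var g).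
Proof.
elim/mpolyind: g => [|c m g _ _ IH]; first by exists 0; rewrite rmorph0 subr0 mul0r.
rewrite rmorphD /= opprD addrACA; apply: dividesD IH.
rewrite -mul_mpolyC rmorphM /= kill_varC -mulrBr; apply: divides_mull.
have -> : 'X_[m] = 'X_i ^+ m i * \prod_(j | j != i) 'X_j ^+ m j :> {mpoly L[n.+1]}.
  by rewrite mpolyXE_id (bigD1 i).
rewrite rmorphM rmorphXn /= kill_varX eqxx.
case: (m i) => [|k]; last first.
  rewrite expr0n mul0r subr0; exists ('X_i ^+ k * \prod_(j | j != i) 'X_j ^+ m j).
  by rewrite exprS; ring.
rewrite !expr0 !mul1r rmorph_prod; exists 0.
rewrite mul0r; apply/eqP; rewrite subr_eq0; apply/eqP.
by apply: eq_bigr => j /negPf ji; rewrite rmorphXn /= kill_varX ji.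
Qed.

End KillVariable.

(** If x_i u = q P and x_i does not divide P, then x_i divides q, because setting x_i to 0 lands in
    a domain. *)
Lemma cancel_var (L : idomainType) n (i : 'I_n.+1) (P u : {mpoly L[n.+1]}) :
  kill_var i P != 0 -> divides P ('X_i * u) -> divides P u.
Proof.
move=> P0 [q Eq].
have q0 : kill_var i q = 0.
  have /eqP := congr1 (kill_var i) Eq.
  rewrite !rmorphM /= kill_varX eqxx mul0r eq_sym mulf_eq0 (negPf P0) orbF.
  by move/eqP.
have := kill_varP i q; rewrite q0 subr0 => -[r Er]; exists r.
apply: (mulfI (x := 'X_i)); last by rewrite Eq Er; ring.
apply/eqP => /(congr1 (fun q : {mpoly L[n.+1]} => q@_U_(i))).
by rewrite mcoeffXU eqxx mcoeff0 => /eqP; rewrite oner_eq0.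
Qed.

(** * Jacobian determinants *)

(** The new matrix is [T *m M], where [T] is the identity with row [i] replaced by [c], and [T] has
    determinant [c i]. *)
Lemma det_row_comb (R : comNzRingType) n (M : 'M[R]_n) (c : 'I_n -> R) (i : 'I_n) :
  \det (\matrix_(a, b) if a == i then \sum_k c k * M k b else M a b) = c i * \det M.
Proof.
pose T : 'M[R]_n := \matrix_(a, k) if a == i then c k else (a == k)%:R.
have -> : (\matrix_(a, b) if a == i then \sum_k c k * M k b else M a b) = T *m M.
  apply/matrixP => a b; rewrite !mxE; case: eqP => [->|/eqP ai].
    by apply: eq_bigr => k _; rewrite mxE eqxx.
  rewrite (bigD1 a) //= mxE (negPf ai) eqxx mul1r big1 ?addr0 // => k ka.
  by rewrite mxE (negPf ai) eq_sym (negPf ka) mul0r.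
rewrite det_mulmx; congr (_ * _).
rewrite (expand_det_col _ i) (bigD1 i) //= big1 => [|a ai]; last first.
  by rewrite mxE (negPf ai) mul0r.
rewrite addr0 mxE eqxx /cofactor -signr_odd oddD addbb mul1r.
suff -> : row' i (col' i T) = 1%:M by rewrite det1 mulr1.
by apply/matrixP => a b; rewrite !mxE eq_sym (negPf (neq_lift _ _)) (inj_eq lift_inj).
Qed.

Lemma det_col_comb (R : comNzRingType) n (M : 'M[R]_n) (c : 'I_n -> R) (i : 'I_n) :
  \det (\matrix_(a, b) if b == i then \sum_k c k * M a k else M a b) = c i * \det M.
Proof.
rewrite -[in RHS]det_tr -det_row_comb -det_tr; congr (\det _).
apply/matrixP => a b; rewrite !mxE; case: ifP => // _.
by apply: eq_bigr => k _; rewrite mxE.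
Qed.

Lemma det_mx2 (R : comNzRingType) (M : 'M[R]_2) :
  \det M = M 0 0 * M 1 1 - M 0 1 * M 1 0.
Proof.
rewrite (expand_det_row _ 0) !big_ord_recl big_ord0 /cofactor !det_mx11 !mxE /= addr0.
rewrite expr0 expr1 mul1r mulN1r mulrN.
by congr (M _ _ * M _ _ - M _ _ * M _ _); apply: val_inj.
Qed.

(** Rows belong to variables and columns to forms, in agreement with the convention of
    [represents_differential]. *)
Definition jacobian (R : comNzRingType) n (F : 'I_n -> {mpoly R[n]}) :=
  \matrix_(a, b) (F b)^`M(a).

Lemma euler (R : comNzRingType) n d (g : {mpoly R[n]}) :
  g \is d.-homog -> \sum_i 'X_i * g^`M(i) = d%:R * g.
Proof.
move=> gd; have md m : m \in msupp g -> mdeg m = d by exact: (dhomog_mf gd).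
transitivity (\sum_i \sum_(m <- msupp g) g@_m *: ('X_i * 'X_[m]^`M(i)) : {mpoly R[n]}).
  apply: eq_bigr => i _; rewrite {1}(mpolyE g) linear_sum mulr_sumr.
  by apply: eq_bigr => m _ /=; rewrite mderivZ scalerAr.
rewrite exchange_big {3}(mpolyE g) mulr_sumr /=; apply: eq_big_seq => m mg.
rewrite -scaler_sumr -scalerAr; congr (_ *: _).
rewrite -(md _ mg) mdegE natr_sum mulr_suml; apply: eq_bigr => i _.
rewrite mderivX scaler_nat mulr_natl mulrnAr; case: (posnP (m i)) => [->|mi].
  by rewrite !mulr0n.
by rewrite -mpolyXD addmC submK // lep1mP -lt0n.
Qed.

(** Combining the rows with weights x_k turns row [i] into d F_b by Euler's relation; the factor d
    then leaves the row. *)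
Lemma euler_det (R : comNzRingType) n d (F : 'I_n -> {mpoly R[n]}) (i : 'I_n) :
  (forall b, F b \is d.-homog) ->
  'X_i * \det (jacobian F) =
    d%:R * \det (\matrix_(a, b) if a == i then F b else (F b)^`M(a)).
Proof.
move=> Fd; rewrite -(det_row_comb (jacobian F) (fun k => 'X_k)).
have := det_row_comb (\matrix_(a, b) if a == i then F b else (F b)^`M(a))
  (fun k => if k == i then d%:R else 0) i.
rewrite eqxx => <-; congr (\det _); apply/matrixP => a b; rewrite !mxE.
case: ifP => [_|ai].
  under eq_bigr => k _ do rewrite mxE.
  rewrite (euler (Fd b)) (bigD1 i) //= eqxx mxE eqxx big1 ?addr0 // => k /negPf ->.
  by rewrite mul0r.
by [].
Qed.

Lemma mderiv_homog (R : nzRingType) n d i (g : {mpoly R[n]}) :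
  g \is d.+1.-homog -> g^`M(i) \is d.-homog.
Proof.
move=> gd; apply/dhomogP => m; rewrite mcoeff_msupp mcoeff_deriv => gm.
have : (m + U_(i))%MM \in msupp g.
  by rewrite mcoeff_msupp; apply: contraNneq gm => ->; rewrite mul0rn.
by move/(dhomog_mf gd) => /=; rewrite mdegD mdeg1 addn1 => -[].
Qed.

Lemma mderiv_homog0 (R : nzRingType) n i (g : {mpoly R[n]}) : g \is 0.-homog -> g^`M(i) = 0.
Proof.
move=> g0; apply/mpolyP => m; rewrite mcoeff_deriv mcoeff0 (dhomog_nemf_coeff g0) ?mul0rn //.
by rewrite /= mdegD mdeg1 addn1.
Qed.

Lemma homog_prodn (R : comNzRingType) n d (I : finType) (f : I -> {mpoly R[n]}) :
  (forall j, f j \is d.-homog) -> \prod_j f j \is (#|I| * d).-homog.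
Proof.
move=> fd; rewrite cardE -big_enum; elim: (enum I) => [|j s IH] /=.
  by rewrite big_nil mul0n dhomog1.
by rewrite big_cons mulSn dhomogM.
Qed.

Lemma jacobian_homog (R : comNzRingType) n d (F : 'I_n -> {mpoly R[n]}) :
  (forall b, F b \is d.+1.-homog) -> \det (jacobian F) \is (n * d).-homog.
Proof.
move=> Fd; apply: rpred_sum => s _.
rewrite mulr_sign; case: ifP => _; rewrite ?rpredN; rewrite -[X in (X * d)%N](card_ord n);
  by apply: homog_prodn => j; rewrite mxE mderiv_homog.
Qed.

Lemma map_mderiv (R T : nzRingType) (f : {rmorphism R -> T}) n i (g : {mpoly R[n]}) :
  map_mpoly f g^`M(i) = (map_mpoly f g)^`M(i).
Proof.
apply/mpolyP => m; rewrite !(mcoeff_map_mpoly, mcoeff_deriv).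
exact: rmorphMn.
Qed.

Lemma map_jacobian (R T : comNzRingType) (f : {rmorphism R -> T}) n
    (F : 'I_n -> {mpoly R[n]}) :
  map_mpoly f (\det (jacobian F)) = \det (jacobian (fun b => map_mpoly f (F b))).
Proof.
rewrite -det_map_mx; congr (\det _); apply/matrixP => a b; rewrite !mxE.
exact: map_mderiv.
Qed.

(** * The Jacobian determinant of the example and its reduction *)

(** The coefficient ring is a parameter because the forms are taken over Z, over the algebraic
    numbers, over a valuation ring and over its residue field. *)
Definition form_over (R : comNzRingType) n d p (i : 'I_n.+1) : {mpoly R[n.+1]} :=
  let x0 : {mpoly R[n.+1]} := 'X_ord0 in
  let x1 : {mpoly R[n.+1]} := 'X_(inord 1) in
  if i == ord0 then
    p%:R * x0 ^+ d
      + 2%:R * x0 * x1 * \sum_(0 <= j < d.-1) x0 ^+ j * x1 ^+ (d - 2 - j)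
  else
    p%:R * 'X_i ^+ d + 2%:R * x1 ^+ d.-1 * 'X_i
      - 2%:R * x0 ^+ d.-1 * 'X_(ordS i).

Lemma map_form_over (R T : comNzRingType) (f : {rmorphism R -> T}) n d p (i : 'I_n.+1) :
  map_mpoly f (form_over R d p i) = form_over T d p i.
Proof.
rewrite /form_over; case: ifP => _.
  rewrite rmorphD !rmorphM !rmorphXn !rmorph_nat /= !map_mpolyX rmorph_sum /=.
  by congr (_ + _ * _); apply: eq_bigr => j _; rewrite rmorphM !rmorphXn /= !map_mpolyX.
by rewrite rmorphB rmorphD !rmorphM !rmorphXn !rmorph_nat /= !map_mpolyX.
Qed.

Lemma homogX (R : nzRingType) n (i : 'I_n) : ('X_i : {mpoly R[n]}) \is 1.-homog.
Proof. by rewrite dhomogX /= mdeg1. Qed.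

Lemma homogXn (R : comNzRingType) n (i : 'I_n) k : ('X_i ^+ k : {mpoly R[n]}) \is k.-homog.
Proof. by have := dhomogMn k (homogX R i); rewrite mul1n. Qed.

Lemma homog_nat_mul (R : comNzRingType) n k d (g : {mpoly R[n]}) :
  g \is d.-homog -> k%:R * g \is d.-homog.
Proof. by move=> gd; rewrite -mpolyC_nat mul_mpolyC; apply: dhomogZ. Qed.

Lemma form_over_homog (R : comNzRingType) n d p (i : 'I_n.+1) : (1 < d)%N ->
  form_over R d p i \is d.-homog.
Proof.
case: d => [|[|e]] // _; rewrite /form_over [_.-1]/=; case: ifP => _.
  apply: rpredD; first exact/homog_nat_mul/homogXn.
  rewrite big_mkord mulr_sumr; apply: rpred_sum => j _; rewrite -!mulrA.
  apply: homog_nat_mul; rewrite mulrA.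
  set k := (e.+2 - 2 - j)%N.
  have -> : e.+2 = (1 + 1 + (j + k))%N by rewrite /k; have := ltn_ord j; lia.
  by apply: dhomogM; apply: dhomogM; rewrite ?homogX ?homogXn.
apply: rpredB; last first.
  rewrite -mulrA; apply: homog_nat_mul; rewrite -[e.+2]addn1.
  by apply: dhomogM; rewrite ?homogXn ?homogX.
apply: rpredD; first exact/homog_nat_mul/homogXn.
rewrite -mulrA; apply: homog_nat_mul; rewrite -[e.+2]addn1.
by apply: dhomogM; rewrite ?homogXn ?homogX.
Qed.

(* By Euler's relation d divides det (jacobian F), while the quotient is still nonzero
   modulo the prime divisors of d. *)
Lemma divided_jacobian n d p : (1 < d)%N ->
  exists J : {mpoly int[n.+1]},
    [/\ d%:R * J = \det (jacobian (form_over int d p)),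
        'X_ord0 * J = \det (\matrix_(a, b < n.+1)
           if a == ord0 then form_over int d p b else (form_over int d p b)^`M(a)) &
        J \is (n.+1 * d.-1).-homog].
Proof.
move=> d1; have dZ : d%:R != 0 :> int by rewrite Num.Theory.pnatr_eq0 -lt0n ltnW.
have := euler_det ord0 (fun b : 'I_n.+1 => form_over_homog int p b d1).
have : \det (jacobian (form_over int (n := n) d p)) \is (n.+1 * d.-1).-homog.
  by apply: jacobian_homog => b; rewrite prednK ?form_over_homog // ltnW.
move: (\det (jacobian _)) => JJ; move: (\det _) => J2 JJh E.
have d0 : (d%:R : {mpoly int[n.+1]}) != 0.
  by rewrite -mpolyC_nat mpolyC_eq0.
(* Modulo x_0 the product d J2 vanishes and d does not, so x_0 divides [J2]; the quotient is the
   required J. *)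
have killJ2 : kill_var ord0 J2 = 0.
  have /eqP := congr1 (kill_var ord0) E.
  rewrite rmorphM /= kill_varX eqxx mul0r eq_sym rmorphM /= rmorph_nat mulf_eq0 (negPf d0) /=.
  by move/eqP.
have := kill_varP ord0 J2; rewrite killJ2 subr0 => -[J EJ].
have X0 : ('X_ord0 : {mpoly int[n.+1]}) != 0.
  by rewrite -msupp_eq0 msuppX.
have EJJ : d%:R * J = JJ.
  by apply: (mulfI X0); rewrite E EJ; ring.
exists J; split=> //; first by rewrite EJ mulrC.
apply/dhomogP => k; rewrite mcoeff_msupp => Jk; apply: (dhomog_mf JJh).
by rewrite mcoeff_msupp -EJJ -mpolyC_nat mcoeffCM mulf_neq0.
Qed.

Section Reduction.

Variables (L : idomainType) (m e : nat).

Local Notation S := {mpoly L[m.+2]}.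
Local Notation i1 := (inord 1 : 'I_m.+2).
Local Notation x := ('X_ord0 : S).
Local Notation y := ('X_i1 : S).

(* (y^e - x^e)/(y - x), and the derivative of y * geom with respect to y. *)
Definition geom : S := \sum_(0 <= j < e) x ^+ j * y ^+ (e.+1 - 2 - j).
Definition dgeom : S := \sum_(0 <= j < e) (e - j)%:R * (x ^+ j * y ^+ (e.+1 - 2 - j)).
(* Half of the b-th form in characteristic p. *)
Definition rform (b : 'I_m.+2) : S :=
  if b == ord0 then x * y * geom else y ^+ e * 'X_b - x ^+ e * 'X_(ordS b).
(* The combination of columns with these weights vanishes outside the first two rows. *)
Definition weight (b : 'I_m.+2) : S :=
  if b == ord0 then 0 else y ^+ ((m.+1 - b) * e) * x ^+ (b.-1 * e).
(** This is R of the overview with n = m+1: the summand b = 1 and the last term add up to (e+1)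
    y^(ne). It is the entry of the combined column in the row of y. *)
Definition rsum : S :=
  \sum_b weight b * (e%:R * y ^+ e.-1 * 'X_b) + y ^+ e * weight i1.
Definition rjac : S :=
  y * geom * rsum - dgeom * (y ^+ (m.+1 * e).+1 - x ^+ (m.+1 * e).+1).

Lemma form_over_rform p b : p%:R = 0 :> L -> form_over L e.+1 p b = 2%:R * rform b.
Proof.
move=> p0; have p0' : p%:R = 0 :> S by rewrite -mpolyC_nat p0.
rewrite /form_over /rform p0' !mul0r !add0r /= -/geom.
by case: ifP => _; ring.
Qed.

Let i1_neq0 : (i1 == ord0) = false.
Proof. by apply/negP => /eqP/(congr1 val); rewrite /= inordK. Qed.

Lemma mderivXn (R : comNzRingType) n (i j : 'I_n) k :
  ('X_j ^+ k : {mpoly R[n]})^`M(i) = (i == j)%:R * (k%:R * 'X_j ^+ k.-1).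
Proof.
rewrite mpolyXn mderivX mulmnE mnm1E eq_sym; case: eqP => [->|_]; last first.
  by rewrite mul0n scale0r mul0r.
rewrite mul1n mul1r mpolyXn scaler_nat mulr_natl; case: k => [|k]; first by rewrite !mulr0n.
by rewrite mulmS addmC addmK.
Qed.

Lemma mderivXi (R : comNzRingType) n (i j : 'I_n) :
  ('X_j : {mpoly R[n]})^`M(i) = (i == j)%:R.
Proof. by have := mderivXn R i j 1; rewrite expr1 expr0 !mulr1. Qed.

Lemma deriv_rform0 a : a != ord0 -> (rform ord0)^`M(a) = (a == i1)%:R * (x * dgeom).
Proof.
move=> a0; rewrite /rform eqxx /geom /dgeom !mulr_sumr raddf_sum /=.
apply: eq_big_nat => j /andP[_ je]; rewrite !mderivM !mderivXn !mderivXi (negPf a0) /= mulr0n.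
rewrite !mul0r ?mulr0 !add0r.
case: eqP => _ /=; last by rewrite !(mulr0n, mul0r, mulr0, addr0).
have -> : (e - j = (e.+1 - 2 - j).+1)%N by lia.
by case: (e.+1 - 2 - j)%N => [|k] /=; rewrite ?exprS mulr1n; ring.
Qed.

Lemma deriv_rform a b : a != ord0 -> b != ord0 ->
  (rform b)^`M(a) = (a == i1)%:R * (e%:R * y ^+ e.-1 * 'X_b) + y ^+ e * (a == b)%:R
    - x ^+ e * (a == ordS b)%:R.
Proof.
move=> a0 b0; rewrite /rform (negPf b0) mderivB !mderivM !mderivXn !mderivXi (negPf a0) /= mulr0n.
ring.
Qed.

(** At k = m the cyclic successor wraps to 0, and [inord] of the out-of-range index m+2 defaults to
    0 as well. *)
Let ordS_inord k : (k <= m)%N -> ordS (inord k.+1 : 'I_m.+2) = inord k.+2.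
Proof.
move=> km; apply: val_inj; rewrite /= inordK //; case: (ltngtP k m) km => // [lt|->] _.
  by rewrite modn_small // inordK.
by rewrite modnn /inord /insubd insubN // -leqNgt.
Qed.

Lemma sum_weight_rform :
  \sum_b weight b * rform b = y ^+ (m.+1 * e).+1 - x ^+ (m.+1 * e).+1.
Proof.
(* The weights are chosen so that the product for index b is T (b-1) - T b and the sum
   telescopes. *)
pose T k : S := y ^+ ((m.+1 - k) * e) * x ^+ (k * e) * 'X_(inord k.+1).
rewrite big_ord_recl /weight eqxx mul0r add0r.
rewrite (eq_bigr (fun b : 'I_m.+1 => T b - T b.+1)) => [|b _].
  rewrite -(big_mkord xpredT (fun k => T k - T k.+1)) -opprB.
  under eq_bigr do rewrite -opprB; rewrite sumrN telescope_sumr // opprB.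
  rewrite /T subn0 mul0n expr0 mulr1 subnn mul0n expr0 mul1r -!exprSr.
  (* The default value of [inord] agrees with the convention x_(n+1) = x_0. *)
  have -> : inord m.+2 = ord0 :> 'I_m.+2; last by rewrite -exprSr opprB.
  by apply: val_inj; rewrite /= /inord /insubd insubN // -leqNgt.
have Eb : lift ord0 b = inord b.+1 :> 'I_m.+2.
  by apply: val_inj; rewrite /= inordK // ltnS.
have b0 : (lift ord0 b == ord0 :> 'I_m.+2) = false by apply/negP => /eqP/(congr1 val).
have bm : (b <= m)%N by rewrite -ltnS.
rewrite /rform b0 Eb ordS_inord // inordK ?ltnS //= /T subSS (subSn bm).
by rewrite !mulSn !exprD; ring.
Qed.

(** Besides the derivatives of y^e, row a receives y^e from column a and -x^e from the preceding
    column. The weights form a geometric progression of ratio x^e / y^e, so these cancel for a >= 2;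
    at a = 1 the preceding weight is 0 and y^e [weight] 1 remains. *)
Lemma sum_weight_deriv a : a != ord0 ->
  \sum_b weight b * (rform b)^`M(a) = (a == i1)%:R * rsum.
Proof.
move=> a0; transitivity (\sum_b ((a == i1)%:R * (weight b * (e%:R * y ^+ e.-1 * 'X_b))
    + (y ^+ e * weight b * (a == b)%:R - x ^+ e * weight b * (a == ordS b)%:R))).
  apply: eq_bigr => b _; case: (eqVneq b ord0) => [->|b0].
    by rewrite /weight eqxx; ring.
  by rewrite deriv_rform //; ring.
rewrite big_split /= -mulr_sumr sumrB [X in _ + (X - _)](bigD1 a) //= eqxx.
rewrite [X in _ + (_ + X - _)]big1 => [|b ba]; last first.
  by rewrite eq_sym (negPf ba) mulr0.
rewrite [X in _ + (_ - X)](bigD1 (ord_pred a)) //= ord_predK eqxx.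
rewrite [X in _ + (_ - (_ + X))]big1 => [|b ba]; last first.
  by rewrite -(inj_eq (can_inj (@ord_predK _))) ordSK eq_sym (negPf ba) mulr0.
rewrite !mulr1 !addr0 /rsum mulrDr; congr (_ + _).
case: (eqVneq a i1) => [->|a1].
  rewrite mul1r; have -> : ord_pred i1 = ord0 :> 'I_m.+2.
    by apply: val_inj; rewrite /= inordK //= modnn.
  by rewrite {2}/weight eqxx mulr0 subr0.
rewrite mul0r; apply/eqP; rewrite subr_eq0; apply/eqP.
have [k Ea km] : exists2 k, val a = k.+2 & (k < m)%N.
  have {}a0 : val a != 0%N by apply: contraNneq a0 => E; apply/eqP/val_inj.
  have {}a1 : val a != 1%N by apply: contraNneq a1 => E; apply/eqP/val_inj; rewrite /= inordK.
  by have := ltn_ord a; exists (a - 2)%N => /=; move: a0 a1 => /=; lia.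
have Ep : val (ord_pred a) = k.+1.
  have Ea' : (a : nat) = k.+2 by [].
  by rewrite /= Ea' (_ : (_ + _).-1 = k.+1 + m.+2)%N // modnDr modn_small // ltnS ltnW.
have pa0 : (ord_pred a == ord0) = false by apply/negP => /eqP/(congr1 val); rewrite Ep.
rewrite /weight (negPf a0) pa0 Ea Ep /= !subSS -(subnSK km).
rewrite !mulSn !exprD; ring.
Qed.

(** Column 1 is replaced by the weighted combination, which multiplies the determinant by y^(me).
    The first two columns then vanish below row 1, and the remaining block is lower triangular with
    diagonal y^e: its determinant y^(me) cancels the factor, and the 2 by 2 corner is x [rjac]. *)
Lemma det_reduction :
  \det (\matrix_(a, b) if a == ord0 then rform b else (rform b)^`M(a)) = x * rjac.
Proof.
set M := \matrix_(a, b) _.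
pose M' : 'M_(2 + m) := \matrix_(a, b) if b == i1 then \sum_k weight k * M a k else M a b.
have detM' : \det M' = weight i1 * \det M by rewrite -det_col_comb.
have wE : weight i1 = y ^+ (m * e).
  by rewrite /weight i1_neq0 inordK //= mul0n expr0 mulr1 subSS subn0.
have X_neq0 (i : 'I_m.+2) : ('X_i : S) != 0 by rewrite -msupp_eq0 msuppX.
apply: (@mulfI _ (y ^+ (m * e))); first by rewrite expf_neq0.
rewrite -wE -detM'.
have l0 : lshift m (0 : 'I_2) = ord0 by apply: val_inj.
have l1 : lshift m (1 : 'I_2) = i1 by apply: val_inj; rewrite /= inordK.
have r0 (a : 'I_m) : (rshift 2 a == ord0 :> 'I_m.+2) = false.
  by apply/negP => /eqP/(congr1 val).
have r1 (a : 'I_m) : (rshift 2 a == i1 :> 'I_m.+2) = false.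
  by apply/negP => /eqP/(congr1 val); rewrite /= inordK.
have i01 : (ord0 == i1) = false by rewrite eq_sym.
have M'1 a : M' a i1 = if a == ord0 then y ^+ (m.+1 * e).+1 - x ^+ (m.+1 * e).+1
                       else (a == i1)%:R * rsum.
  rewrite mxE eqxx; case: eqVneq => [->|a0].
    by rewrite -sum_weight_rform; apply: eq_bigr => k _; rewrite mxE eqxx.
  by rewrite -sum_weight_deriv //; apply: eq_bigr => k _; rewrite mxE (negPf a0).
have M'0 a : M' a ord0 = if a == ord0 then rform ord0 else (a == i1)%:R * (x * dgeom).
  by rewrite mxE i01 mxE; case: eqVneq => // a0; rewrite deriv_rform0.
have M'r (a b : 'I_m) : M' (rshift 2 a) (rshift 2 b) =
    y ^+ e * (a == b)%:R - x ^+ e * (rshift 2 a == ordS (rshift 2 b : 'I_m.+2))%:R.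
  by rewrite mxE r1 mxE r0 deriv_rform ?r0 // r1 mul0r add0r (inj_eq (@rshift_inj 2 m)).
clearbody M'.
have dl0 : dlsubmx M' = 0.
  apply/matrixP => a b; rewrite !mxE; case: (unliftP 0 b) => [c|] ->; last first.
    by rewrite l0 M'0 r0 r1 mul0r.
  have -> : lshift m (lift 0 c) = i1 by rewrite -l1 (ord1 c); apply: val_inj.
  by rewrite M'1 r0 r1 mul0r.
rewrite -(submxK M') dl0 det_ublock det_mx2 !mxE l0 l1.
have -> : \det (drsubmx M') = y ^+ (m * e).
  rewrite det_trig.
    rewrite (eq_bigr (fun _ => y ^+ e)) => [|a _].
      by rewrite prodr_const card_ord -exprM mulnC.
    rewrite !mxE M'r eqxx (_ : (_ == _) = false); first by rewrite mulr1 mulr0 subr0.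
    by apply/negP => /eqP/(congr1 val); rewrite /= !add2n; have := ltn_ord a;
      case: (ltngtP a.+1 m) => // [lt|->]; rewrite ?modnn ?modn_small //; lia.
  apply/is_trig_mxP => a b ab; rewrite !mxE M'r.
  rewrite -[a == b]val_eqE /= (ltn_eqF ab) (_ : (_ == ordS _) = false).
    by rewrite !mulr0 subr0.
  apply/negP => /eqP/(congr1 val); rewrite /= !add2n; have := ltn_ord b; move: ab.
  by case: (ltngtP b.+1 m) => // [lt|->]; rewrite ?modnn ?modn_small //; lia.
rewrite !M'0 !M'1 !eqxx i1_neq0 /rform eqxx wE /rjac /= mulr1n; ring.
Qed.

End Reduction.

(** * The reduced Jacobian determinant is prime *)

Section ReducedJacobianPrime.

Variables (L : fieldType) (m e : nat).
Hypotheses (m_gt0 : (0 < m)%N) (e_gt0 : (0 < e)%N) (e_neq0 : e%:R != 0 :> L).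

Local Notation S := {mpoly L[m.+2]}.
Local Notation i1 := (inord 1 : 'I_m.+2).
Local Notation x := ('X_ord0 : S).
Local Notation y := ('X_i1 : S).
Local Notation geom := (geom L m e).
Local Notation dgeom := (dgeom L m e).
Local Notation weight := (weight L e).
Local Notation rsum := (rsum L m e).
Local Notation rjac := (rjac L m e).

Let X_neq0 (i : 'I_m.+2) : ('X_i : S) != 0. Proof. by rewrite -msupp_eq0 msuppX. Qed.

Let i1_neq0 : (i1 == ord0) = false.
Proof. by apply/negP => /eqP/(congr1 val); rewrite /= inordK. Qed.

Let y_exp_pred : y * y ^+ e.-1 = y ^+ e. Proof. by rewrite -exprS prednK. Qed.

Lemma geom_mul : (y - x) * geom = y ^+ e - x ^+ e.
Proof.
rewrite subrXX; congr (_ * _); rewrite /geom big_mkord; apply: eq_bigr => j _.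
by rewrite mulrC; congr (_ ^+ _ * _); lia.
Qed.

(** Comes from differentiating (y - x)(x y geom) = x y (y^e - x^e) with respect to y; the factor x
    is kept because [deriv_rform0] knows the derivative of x y geom. *)
Lemma dgeom_mul : (y - x) * dgeom = (e%:R + 1) * y ^+ e - x ^+ e - y * geom.
Proof.
apply: (mulfI (X_neq0 ord0)).
have : (x * y * ((y - x) * geom))^`M(i1) = (x * y * (y ^+ e - x ^+ e))^`M(i1).
  by rewrite geom_mul.
have -> : x * y * ((y - x) * geom) = (y - x) * (x * y * geom) by ring.
have D : (x * y * geom)^`M(i1) = x * dgeom.
  have : (rform L e ord0)^`M(i1) = (i1 == i1)%:R * (x * dgeom).
    by apply: deriv_rform0; rewrite i1_neq0.
  by rewrite /rform !eqxx mul1r.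
rewrite mderivM D !(mderivM, mderivB) !mderivXn !mderivXi.
rewrite i1_neq0 eqxx /= mulr0n mulr1n -y_exp_pred => /(congr1 (fun t => t - x * y * geom)) E.
by apply: etrans (etrans _ E) _; ring.
Qed.

Lemma kill0_geom : kill_var ord0 geom = y ^+ e.-1.
Proof.
rewrite /geom big_ltn // rmorphD rmorph_sum /= rmorphM !rmorphXn /= !kill_varX i1_neq0.
rewrite eqxx expr0 mul1r big_nat big1 ?addr0 => [|j /andP[j0 _]].
  by congr (_ ^+ _); lia.
by rewrite rmorphM !rmorphXn /= kill_varX eqxx expr0n -[j == _]negbK -lt0n j0 mul0r.
Qed.

Lemma kill0_dgeom : kill_var ord0 dgeom = e%:R * y ^+ e.-1.
Proof.
rewrite /dgeom big_ltn // rmorphD rmorph_sum /= 2!rmorphM !rmorphXn /= rmorph_nat !kill_varX.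
rewrite i1_neq0 eqxx expr0 mul1r subn0 big_nat big1 ?addr0 => [|j /andP[j0 _]].
  by congr (_ * _ ^+ _); lia.
rewrite 2!rmorphM !rmorphXn /= kill_varX eqxx expr0n -[j == _]negbK -lt0n j0 mul0r.
by rewrite mulr0.
Qed.

Lemma kill1_dgeom : kill_var i1 dgeom = x ^+ e.-1.
Proof.
rewrite /dgeom; case: (e) e_gt0 => // k _ /=.
rewrite big_nat_recr //= subSnn !subSS subn0 subnn expr0 mulr1 mul1r.
rewrite rmorphD rmorph_sum rmorphXn /= kill_varX eq_sym i1_neq0.
rewrite big_nat big1 ?add0r // => j /andP[_ jk].
have kj : (k - j == 0)%N = false by rewrite subn_eq0 leqNgt jk.
rewrite 2!rmorphM !rmorphXn /= !kill_varX eqxx ?subSS ?subn0 expr0n kj.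
by rewrite !mulr0.
Qed.

(** With n = m+1, modulo x the two products are (e+1) y^((n+1)e) and e y^((n+1)e); their difference
    has coefficient 1, whatever the characteristic. *)
Lemma kill0_rjac : kill_var ord0 rjac = y ^+ (m.+2 * e).
Proof.
have kw b : kill_var ord0 (weight b) = if b == i1 then y ^+ (m * e) else 0.
  rewrite /weight; case: (eqVneq b ord0) => [->|b0]; first by rewrite rmorph0 eq_sym i1_neq0.
  rewrite rmorphM !rmorphXn /= !kill_varX i1_neq0 eqxx.
  case: (eqVneq b i1) => [->|b1]; first by rewrite inordK //= mul0n expr0 mulr1 subSS subn0.
  have b1' : (b : nat) != 1%N by apply: contraNneq b1 => E; apply/eqP/val_inj; rewrite /= inordK.
  have b0' : (b : nat) != 0%N by apply: contraNneq b0 => E; apply/eqP/val_inj.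
  rewrite expr0n (_ : (_ == 0)%N = false) ?mulr0 //.
  by apply/negP; rewrite muln_eq0 => /orP[]/eqP; lia.
rewrite /rjac rmorphB 3!rmorphM rmorphB rmorphXn [X in _ - _ * (_ - X)]rmorphXn /=.
rewrite kill0_geom kill0_dgeom !kill_varX i1_neq0 eqxx expr0n /= subr0.
rewrite /rsum rmorphD rmorph_sum (bigD1 i1) //= big1 => [|b b1]; last first.
  by rewrite rmorphM /= kw (negPf b1) mul0r.
rewrite !rmorphM /= rmorph_nat !rmorphXn /= !kw eqxx !kill_varX i1_neq0.
by rewrite !mulSn !(exprS, exprD) -y_exp_pred; ring.
Qed.

Lemma kill1_rjac : kill_var i1 rjac = x ^+ (e.-1 + (m.+1 * e).+1).
Proof.
rewrite /rjac rmorphB 3!rmorphM rmorphB !rmorphXn /= kill1_dgeom !kill_varX eqxx eq_sym i1_neq0.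
rewrite expr0n /= !mul0r sub0r exprD; ring.
Qed.

(** Where geom vanishes, y^e = x^e, so (y - x) dgeom becomes e x^e and y^(ne+1) - x^(ne+1) becomes
    (y - x) x^(ne). The factor y - x needed by the first is supplied by the second. *)
Lemma rjac_mod_geom : exists s, rjac = geom * s - e%:R * x ^+ (m.+2 * e).
Proof.
have [W EW] : exists W, y ^+ (m.+1 * e) - x ^+ (m.+1 * e) = (y - x) * geom * W.
  rewrite mulnC !exprM subrXX -geom_mul; by eexists.
pose U := (e%:R + 1) * (y - x) - y.
have E1 : (y - x) * dgeom = e%:R * x ^+ e + geom * U.
  rewrite dgeom_mul /U.
  have -> : y ^+ e = (y - x) * geom + x ^+ e by rewrite geom_mul subrK.
  ring.
have E2 : dgeom * (y ^+ (m.+1 * e).+1 - x ^+ (m.+1 * e).+1) =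
    ((y - x) * dgeom) * (geom * W * y + x ^+ (m.+1 * e)).
  rewrite !exprS.
  have -> : y ^+ (m.+1 * e) = (y - x) * geom * W + x ^+ (m.+1 * e) by rewrite -EW subrK.
  ring.
exists (y * rsum - (U * (geom * W * y + x ^+ (m.+1 * e)) + e%:R * x ^+ e * W * y)).
by rewrite /rjac E2 E1 [(m.+2 * e)%N]mulSn exprD; ring.
Qed.

Lemma cancel_varX (i : 'I_m.+2) k (P u : S) :
  kill_var i P != 0 -> divides P ('X_i ^+ k * u) -> divides P u.
Proof.
move=> P0; elim: k => [|k IH]; first by rewrite expr0 mul1r.
by rewrite exprS -mulrA => /(cancel_var P0)/IH.
Qed.

Let cancel_x k u : divides rjac (x ^+ k * u) -> divides rjac u.
Proof. by apply: cancel_varX; rewrite kill0_rjac expf_neq0. Qed.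

Let cancel_y k u : divides rjac (y ^+ k * u) -> divides rjac u.
Proof. by apply: cancel_varX; rewrite kill1_rjac expf_neq0. Qed.

Let cancel_e u : divides rjac (e%:R * u) -> divides rjac u.
Proof.
move=> /(divides_mull (e%:R^-1)%:MP); rewrite mulrA -mpolyC_nat -mpolyCM mulVf //.
by rewrite mpolyC1 mul1r.
Qed.

(** By [rjac_mod_geom], a multiple of geom is congruent to e x^N modulo [rjac], and both e and x can
    already be cancelled. *)
Let cancel_geom u : divides rjac (geom * u) -> divides rjac u.
Proof.
move=> gu; have [s Es] := rjac_mod_geom.
apply: (@cancel_x (m.+2 * e)); apply: cancel_e.
have -> : e%:R * (x ^+ (m.+2 * e) * u) = s * (geom * u) + - (u * rjac) by rewrite Es; ring.
by apply: dividesD; [apply: divides_mull|apply: dividesN; exists u].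
Qed.

(* g does not involve the last variable. *)
Let indep (g : S) := exists c, widen_var ord_max c = g.

Let indepD g h : indep g -> indep h -> indep (g + h).
Proof. by move=> [c <-] [d <-]; exists (c + d); rewrite rmorphD. Qed.
Let indepN g : indep g -> indep (- g).
Proof. by move=> [c <-]; exists (- c); rewrite rmorphN. Qed.
Let indepM g h : indep g -> indep h -> indep (g * h).
Proof. by move=> [c <-] [d <-]; exists (c * d); rewrite rmorphM. Qed.
Let indepXn g k : indep g -> indep (g ^+ k).
Proof. by move=> [c <-]; exists (c ^+ k); rewrite rmorphXn. Qed.
Let indep_nat k : indep k%:R.
Proof. by exists k%:R; rewrite rmorph_nat. Qed.
Let indep_sum (I : eqType) (r : seq I) (P : pred I) (f : I -> S) :
  (forall j, P j -> indep (f j)) -> indep (\sum_(j <- r | P j) f j).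
Proof. by move=> fi; apply: big_ind => //; exact: (indep_nat 0). Qed.
Let indepX i : i != ord_max -> indep 'X_i.
Proof.
case: (unliftP ord_max i) => [k|] ->; last by rewrite eqxx.
by exists 'X_k; rewrite widen_varX.
Qed.

Let indep_x : indep x. Proof. exact/indepX. Qed.
Let indep_y : indep y.
Proof.
(* Here n >= 2 enters: for n = 1 the variable y would be the last one. *)
apply/indepX; apply/negP => /eqP/(congr1 val); rewrite /= inordK // => -[E].
by move: m_gt0; rewrite -E.
Qed.
Let indep_geom : indep geom.
Proof. by apply: indep_sum => j _; apply: indepM; apply: indepXn. Qed.
Let indep_dgeom : indep dgeom.
Proof. by apply: indep_sum => j _; apply: indepM => //; apply: indepM; apply: indepXn. Qed.
Let indep_weight b : indep (weight b).
Proof.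
rewrite /weight; case: ifP => _; first exact: (indep_nat 0).
by apply: indepM; apply: indepXn.
Qed.

(** The last variable occurs only in one summand of [rsum], so [rjac] is linear in it; its
    coefficient [A] is e x^(me) y^e geom, a product of factors that can each be cancelled modulo
    [rjac]. *)
Lemma rjac_prime : prime_element rjac.
Proof.
pose A := y * geom * (weight ord_max * (e%:R * y ^+ e.-1)).
pose B := y * geom * (\sum_(b | b != ord_max) weight b * (e%:R * y ^+ e.-1 * 'X_b)
    + y ^+ e * weight i1) - dgeom * (y ^+ (m.+1 * e).+1 - x ^+ (m.+1 * e).+1).
have [a Ea] : indep A.
  by apply: indepM; apply: indepM => //; apply: indepM => //; apply: indepXn.
have [b Eb] : indep B.
  apply: indepD; last first.
    by apply/indepN/indepM => //; apply/indepD; [|apply/indepN]; apply: indepXn.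
  apply: indepM; first exact: indepM.
  apply: indepD; last by apply: indepM => //; apply: indepXn.
  apply: indep_sum => j jm; apply: indepM => //; apply: indepM; last exact: indepX.
  by apply: indepM => //; apply: indepXn.
have E : rjac = widen_var ord_max a * 'X_ord_max + widen_var ord_max b.
  by rewrite Ea Eb /A /B /rjac /rsum (bigD1 ord_max) //=; ring.
have wE : weight ord_max = x ^+ (m * e).
  by rewrite /weight (_ : (ord_max == ord0) = false) ?subnn ?mul0n ?expr0 ?mul1r.
rewrite E; apply: linear_mpoly_prime; last first.
  move=> u; rewrite -E Ea /A wE => H.
  apply: cancel_geom; apply: (@cancel_x (m * e)); apply: cancel_e.
  apply: (@cancel_y e); rewrite -y_exp_pred.
  by move: H; congr (divides _ _); ring.
have geom0 : geom != 0.
  apply/eqP => /(congr1 (kill_var ord0)) /eqP.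
  by rewrite kill0_geom rmorph0 expf_eq0 (negPf (X_neq0 _)) andbF.
have : A != 0.
  rewrite /A wE !mulf_neq0 ?expf_neq0 // -mpolyC_nat mpolyC_eq0 //.
by apply: contraNneq => a0; rewrite -Ea a0 rmorph0.
Qed.

End ReducedJacobianPrime.

Lemma prime_elementMl (R : comNzRingType) (c c' g : R) :
  c' * c = 1 -> prime_element g -> prime_element (c * g).
Proof.
move=> cc' gP a b [q Eq].
have div u : divides g u -> divides (c * g) u.
  by case=> r ->; exists (r * c'); rewrite mulrA -[r * _ * _]mulrA cc' mulr1.
by case: (gP a b) => [|/div|/div]; [exists (q * c); rewrite Eq mulrA|left|right].
Qed.

Lemma jacobian_prime n d p : (2 <= n)%N -> (2 <= d)%N -> prime p -> odd p ->
    ~~ (p %| d - 1)%N ->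
  exists J : {mpoly algC[n.+1]},
    [/\ d%:R * J = \det (jacobian (form_over algC d p)), J \is (n.+1 * d.-1).-homog,
        J != 0 & prime_element J].
Proof.
case: n => // m m_gt0; case: d => // e e_gt0 p_prime p_odd; rewrite subn1 /= => pe.
have [J [dJ xJ J_homog]] := @divided_jacobian m.+1 e.+1 p e_gt0.
pose JK := map_mpoly (intr : int -> algC) J.
have char0 k : k.+1%:R != 0 :> algC by rewrite Num.Theory.pnatr_eq0.
have [A [L [iota [res [iota_inj p0 res_unit val_A]]]]] :=
  exists_place (prime_gt1 p_prime) char0.
have pL : p \in [pchar L] by rewrite inE p_prime p0 eqxx.
have two_neq0 : 2%:R != 0 :> L.
  rewrite -(dvdn_pcharf pL); apply/negP => /(@dvdn_leq p 2 isT) p2.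
  by move: p_odd p_prime; case: p p2 {pe dJ xJ p0 pL} => [|[|[]]].
have e_neq0 : e%:R != 0 :> L by rewrite -(dvdn_pcharf pL).
pose JL := map_mpoly (intr : int -> L) J.
have map_homog (R : nzRingType) : map_mpoly (intr : int -> R) J \is (m.+2 * e).-homog.
  apply/dhomogP => k; rewrite mcoeff_msupp mcoeff_map_mpoly => Jk.
  by apply: (dhomog_mf J_homog); rewrite mcoeff_msupp; apply: contraNneq Jk => ->; rewrite raddf0.
have X_neq0 (i : 'I_m.+2) : ('X_i : {mpoly L[m.+2]}) != 0 by rewrite -msupp_eq0 msuppX.
have JLE : JL = 2%:R ^+ m.+2 * rjac L m e.
  (* The identity for d J is void modulo p when p divides d; the one for x_0 J is not. *)
  apply: (mulfI (X_neq0 ord0)); rewrite mulrCA -det_reduction.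
  have -> : 'X_ord0 * JL = map_mpoly (intr : int -> L) ('X_ord0 * J).
    by rewrite rmorphM /= map_mpolyX.
  rewrite xJ -det_map_mx -detZ; congr (\det _).
  apply/matrixP => a b; rewrite !mxE.
  have mf : map_mpoly intr (form_over int e.+1 p b) = 2%:R * rform L e b.
    by rewrite map_form_over form_over_rform.
  case: ifP => _ //.
  by rewrite [LHS]map_mderiv mf -mpolyC_nat mderiv_mulC.
have twoK : (2%:R ^- m.+2)%:MP * (2%:R ^+ m.+2 : {mpoly L[m.+2]}) = 1.
  have -> : 2%:R ^+ m.+2 = (2%:R ^+ m.+2)%:MP :> {mpoly L[m.+2]}.
    by rewrite rmorphXn /= mpolyC_nat.
  by rewrite -mpolyCM mulVf ?mpolyC1 // expf_neq0.
have JL_prime : prime_element JL.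
  by rewrite JLE; apply: prime_elementMl twoK (rjac_prime m_gt0 e_gt0 e_neq0).
pose i1 : 'I_m.+2 := inord 1.
(* This coefficient is the value at the point with x_1 = 1 and other coordinates 0, where [rjac] is
   1 because it is y^N modulo x. *)
have JL_top : JL@_(U_(i1) *+ (m.+2 * e))%MM != 0.
  rewrite -meval_homog_delta ?map_homog // JLE rmorphM rmorphXn rmorph_nat /=.
  rewrite mulf_neq0 ?expf_neq0 //.
  have [q /eqP] := kill_varP ord0 (rjac L m e); rewrite subr_eq => /eqP->.
  rewrite rmorphD rmorphM kill0_rjac // rmorphXn /= !mevalXU eqxx.
  rewrite (_ : (ord0 == i1) = false) ?mulr0 ?add0r ?expr1n ?oner_neq0 //.
  by apply/negP => /eqP/(congr1 val); rewrite /= inordK.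
have map_int (R T : comNzRingType) (f : {rmorphism R -> T}) :
    map_mpoly f (map_mpoly (intr : int -> R) J) = map_mpoly (intr : int -> T) J.
  by apply/mpolyP => k; rewrite !mcoeff_map_mpoly /= rmorph_int.
exists JK; split.
- have <- : map_mpoly intr (e.+1%:R * J) = e.+1%:R * JK by rewrite rmorphM rmorph_nat.
  rewrite dJ map_jacobian; congr (\det _); apply/matrixP => a b; rewrite !mxE.
  by rewrite map_form_over.
- exact: map_homog.
- apply: contraNneq JL_top => /(congr1 (mcoeff (U_(i1) *+ (m.+2 * e))%MM)) /eqP.
  rewrite mcoeff_map_mpoly mcoeff0 intr_eq0 => /eqP J0.
  by rewrite mcoeff_map_mpoly J0 raddf0.
- rewrite /JK -(map_int _ _ iota).
  apply: (lift_prime_element iota_inj res_unit val_A (N := m.+2 * e) (i := i1)).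
  + exact: map_homog.
  + by rewrite -(mcoeff_map_mpoly res) map_int.
  + by rewrite map_int.
Qed.

(** * Good reduction at 2 *)

Lemma meval_map_mpoly (R T : comNzRingType) (f : {rmorphism R -> T}) n v (g : {mpoly R[n]}) :
  (map_mpoly f g).@[fun i => f (v i)] = f g.@[v].
Proof.
apply: (@mpoly_rmorph_ext _ _ _
  (meval (fun i => f (v i)) \o map_mpoly f : {rmorphism _ -> _})
  (f \o meval v : {rmorphism _ -> _})) => [c|i] /=.
  by rewrite map_mpolyC /= !mevalC.
by rewrite map_mpolyX !mevalXU.
Qed.

Lemma meval_homog_scale (R : comNzRingType) n d c v (g : {mpoly R[n]}) : g \is d.-homog ->
  g.@[fun i => c * v i] = c ^+ d * g.@[v].
Proof.
move=> gd; rewrite !mevalE mulr_sumr; apply: eq_big_seq => m mg.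
rewrite mulrCA; congr (_ * _); have <- : mdeg m = d by exact: (dhomog_mf gd).
rewrite mdegE -prodrXr -big_split /=.
by apply: eq_bigr => i _; rewrite exprMn.
Qed.

(* Reduction modulo a place above 2 turns the i-th form into p x_i^d. *)
Lemma form_over_no_zero (L : fieldType) n d p (x : 'I_n.+1 -> L) :
  (forall k, k.+1%:R != 0 :> L) -> (1 < d)%N -> odd p ->
  (forall i, (form_over L d p i).@[x] = 0) -> forall i, x i = 0.
Proof.
move=> char0 d1 p_odd zero i; apply/eqP; apply: contraT => xi0.
have [A [k [iota [res [iota_inj two0 res_unit val_A]]]]] := exists_place (isT : 1 < 2)%N char0.
(* The coordinates are scaled into the valuation ring so that one of them is 1; the contradiction is
   that all residues vanish. *)
have [|c c0 [cA c1]] := @primitive_scaling _ _ iota val_A [seq x j | j <- enum 'I_n.+1].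
  by apply/hasP; exists (x i) => //; apply/map_f/mem_enum.
have xA j : exists a, iota a = c * x j by apply/cA/map_f/mem_enum.
pose a j := projT1 (boolp.cid (xA j)); have aP j : iota (a j) = c * x j.
  exact: projT2 (boolp.cid (xA j)).
have zeroA j : (form_over A d p j).@[a] = 0.
  apply: iota_inj; rewrite -meval_map_mpoly map_form_over rmorph0.
  rewrite (meval_eq _ aP) (@meval_homog_scale _ _ d) ?zero ?mulr0 //.
  exact: form_over_homog.
have p1 : p%:R = 1 :> k.
  by rewrite -(odd_double_half p) p_odd natrD -muln2 natrM two0 mulr0 addr0.
have res0 j : res (a j) = 0.
  have /(congr1 res) := zeroA j; rewrite -meval_map_mpoly map_form_over rmorph0.
  have two0' : 2%:R = 0 :> {mpoly k[n.+1]} by rewrite -mpolyC_nat two0.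
  have p1' : p%:R = 1 :> {mpoly k[n.+1]} by rewrite -mpolyC_nat p1.
  suff -> : form_over k d p j = 'X_j ^+ d.
    by rewrite rmorphXn /= mevalXU => /eqP; rewrite expf_eq0 => /andP[_ /eqP].
  by rewrite /form_over; case: eqVneq => [->|_]; rewrite two0' p1'; ring.
move: c1 => /mapP[y /mapP[j _ ->]]; rewrite -aP -(rmorph1 iota) => /iota_inj aj.
by have /eqP := res0 j; rewrite -aj rmorph1 oner_eq0.
Qed.

(** The images of the variables form a common zero of the forms over [L]. An arbitrary [L] covers
    evaluations at points and also residue fields of homogeneous primes. *)
Lemma example_kernel (L : fieldType) n d p (phi : {rmorphism {mpoly algC[n.+1]} -> L}) :
  (1 < d)%N -> odd p -> (forall i, phi (example_form d p i) = 0) ->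
  forall i, phi 'X_i = 0.
Proof.
move=> d1 p_odd zero.
apply: (@form_over_no_zero L n d p (fun i => phi 'X_i)) => // [k|i].
  rewrite -(rmorph_nat phi) -mpolyC_nat; apply/eqP => E.
  have := rmorph1 phi; have <- : (k.+1%:R^-1)%:MP * (k.+1%:R)%:MP = 1 :> {mpoly algC[n.+1]}.
    by rewrite -mpolyCM mulVf ?mpolyC1 // Num.Theory.pnatr_eq0.
  by rewrite rmorphM E mulr0 => /eqP; rewrite eq_sym oner_eq0.
rewrite -[RHS](zero i); have <- : map_mpoly intr (form_over int d p i) = example_form d p i.
  exact: map_form_over.
have <- : map_mpoly intr (form_over int d p i) = form_over L d p i by exact: map_form_over.
(* On constants [phi] may be any embedding of the algebraic numbers, but both sides come from Z[x],
   where the images of the variables decide. *)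
apply: (@mpoly_rmorph_ext _ _ _
  (meval (fun i => phi 'X_i) \o map_mpoly intr : {rmorphism _ -> _})
  (phi \o map_mpoly intr : {rmorphism _ -> _})) => [c|j] /=.
  rewrite !map_mpolyC /= mevalC.
  have -> : c%:~R%:MP = c%:~R :> {mpoly algC[n.+1]} by exact: (rmorph_int (@mpolyC n.+1 algC)).
  by rewrite rmorph_int.
by rewrite !map_mpolyX mevalXU.
Qed.

Lemma example_endomorphism n d p : (1 < d)%N -> odd p -> endomorphism (example_map n d p) d.
Proof.
move=> d1 p_odd; split=> [i|x zero]; first by rewrite tnth_mktuple; exact: form_over_homog.
move=> i; rewrite -(mevalXU x).
apply: (example_kernel (phi := meval x) d1 p_odd) => j.
by have := zero j; rewrite tnth_mktuple.
Qed.

Lemma example_defined_over_rat n d p : defined_over_rat (example_map n d p).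
Proof.
exists 1; first exact: oner_neq0.
move=> i; rewrite scale1r tnth_mktuple.
have <- : map_mpoly intr (form_over int d p i) = example_form d p i by exact: map_form_over.
apply/(mpolyOverP _) => m; rewrite mcoeff_map_mpoly.
exact: rpred_int.
Qed.

Lemma proj_point_prime n (k : closedFieldType) (P : proj_point n k) : prime_ideal P.
Proof.
split; [exact: prime_of0|exact: prime_ofD|exact: prime_ofM|exact: prime_of_prime|].
by move=> P1; have [i] := prime_of_relevant P; apply; rewrite -['X_i]mulr1; apply: prime_ofM.
Qed.

(** Provides a chart of the target around f(P) for every point of the scheme, closed or not. *)
Lemma example_relevant n d p (P : proj_point n algC) : (1 < d)%N -> odd p ->
  exists i, ~ P (tnth (example_map n d p) i).
Proof.
move=> d1 p_odd; apply: boolp.contrapT => allP.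
have [L [phi phiP]] := prime_ideal_kernel (proj_point_prime P).
have [i] := prime_of_relevant P; apply; apply/phiP.
apply: (example_kernel (phi := phi) d1 p_odd) => j; apply/phiP; apply: boolp.contrapT => nP.
by apply: allP; exists j; rewrite tnth_mktuple.
Qed.

(** * Local rings and coordinate frames *)

Lemma frac_of_pair (R : idomainType) (s : {fraction R}) :
  exists a b : R, b != 0 /\ s = FracField.tofrac a / FracField.tofrac b.
Proof.
elim/quotW: s => r; exists \n_r, \d_r; split; first exact: denom_ratioP.
have d0 : FracField.tofrac \d_r != 0 by rewrite tofrac_eq0 denom_ratioP.
apply: (mulIf d0); rewrite divfK // /FracField.tofrac.
have := FracField.pi_mul r (Ratio \d_r 1); rewrite /FracField.mulf.
rewrite !numden_Ratio ?oner_neq0 // mulr1 => E.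
rewrite -!lock; apply: etrans (esym E) _; apply/eqmodP.
rewrite /= FracField.equivfE !numden_Ratio ?oner_neq0 ?denom_ratioP //.
by rewrite mulr1 mulrC.
Qed.

Lemma frac_eq (R : idomainType) (a b c d : R) : b != 0 -> d != 0 ->
  (FracField.tofrac a / FracField.tofrac b == FracField.tofrac c / FracField.tofrac d) =
    (a * d == c * b).
Proof. by move=> b0 d0; rewrite eqr_div ?tofrac_eq0 // -!tofracM tofrac_eq. Qed.

Lemma frac_add (R : idomainType) (a b c d : R) : b != 0 -> d != 0 ->
  FracField.tofrac a / FracField.tofrac b + FracField.tofrac c / FracField.tofrac d =
    FracField.tofrac (a * d + c * b) / FracField.tofrac (b * d).
Proof. by move=> b0 d0; rewrite addf_div ?tofrac_eq0 // tofracD !tofracM. Qed.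

Lemma frac_mul (R : idomainType) (a b c d : R) :
  (FracField.tofrac a / FracField.tofrac b) * (FracField.tofrac c / FracField.tofrac d) =
    FracField.tofrac (a * c) / FracField.tofrac (b * d).
Proof. by rewrite mulf_div !tofracM. Qed.

Section LocalGeometry.

Variables (n : nat) (k : closedFieldType).

Local Notation S := {mpoly k[n.+1]}.
Local Notation K := {fraction S}.
Local Notation "g '%:F'" := (FracField.tofrac g : K) (at level 1, format "g %:F").

Let FD (a b : S) : (a + b)%:F = a%:F + b%:F. Proof. exact: tofracD. Qed.
Let FM (a b : S) : (a * b)%:F = a%:F * b%:F. Proof. exact: tofracM. Qed.
Let F_inj (a b : S) : a%:F = b%:F -> a = b.
Proof. by move=> /eqP; rewrite tofrac_eq => /eqP. Qed.
Let F_neq0 (a : S) : a != 0 -> a%:F != 0. Proof. by rewrite tofrac_eq0. Qed.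

Section FractionDerivative.

Variable i : 'I_n.+1.

Lemma frac_deriv_exists (s : K) : exists t : K, exists a b : S,
  [/\ b != 0, s = a%:F / b%:F & t = (a^`M(i) * b - a * b^`M(i))%:F / (b * b)%:F].
Proof.
have [a [b [b0 ->]]] := frac_of_pair s.
by exists ((a^`M(i) * b - a * b^`M(i))%:F / (b * b)%:F), a, b.
Qed.

Definition frac_deriv (s : K) : K := projT1 (boolp.cid (frac_deriv_exists s)).

(** Independence of the chosen fraction: differentiating a d = c b yields what cross multiplication
    of the two quotient rules asks for. *)
Lemma frac_derivE (a b : S) : b != 0 ->
  frac_deriv (a%:F / b%:F) = (a^`M(i) * b - a * b^`M(i))%:F / (b * b)%:F.
Proof.
move=> b0; rewrite /frac_deriv; case: boolp.cid => t /= [c [d [d0 E ->]]].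
have {}E : a * d = c * b.
  apply: F_inj; rewrite !FM; apply/eqP; rewrite -eqr_div ?F_neq0 //; exact/eqP.
have E' : a^`M(i) * d + a * d^`M(i) = c^`M(i) * b + c * b^`M(i) by rewrite -!mderivM E.
apply/eqP; rewrite eqr_div ?F_neq0 ?mulf_neq0 // -!FM; apply/eqP; congr (_%:F).
have -> : (c^`M(i) * d - c * d^`M(i)) * (b * b) =
    (c^`M(i) * b) * (b * d) - (c * b) * (b * d^`M(i)) by ring.
have -> : c^`M(i) * b = a^`M(i) * d + a * d^`M(i) - c * b^`M(i) by rewrite E' addrK.
rewrite -E.
have -> : (a^`M(i) * d + a * d^`M(i) - c * b^`M(i)) * (b * d) =
    (a^`M(i) * d + a * d^`M(i)) * (b * d) - (c * b) * (b^`M(i) * d) by ring.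
by rewrite -E; ring.
Qed.

Lemma frac_derivD s t : frac_deriv (s + t) = frac_deriv s + frac_deriv t.
Proof.
have [a [b [b0 ->]]] := frac_of_pair s; have [c [d [d0 ->]]] := frac_of_pair t.
rewrite addf_div ?F_neq0 // -!FM -FD !frac_derivE ?mulf_neq0 // addf_div ?F_neq0 ?mulf_neq0 //.
rewrite -!FM -FD; apply/eqP; rewrite eqr_div ?F_neq0 ?mulf_neq0 // -!FM; apply/eqP.
by congr (_%:F); rewrite mderivD !mderivM; ring.
Qed.

Lemma frac_derivM s t : frac_deriv (s * t) = s * frac_deriv t + t * frac_deriv s.
Proof.
have [a [b [b0 ->]]] := frac_of_pair s; have [c [d [d0 ->]]] := frac_of_pair t.
rewrite mulf_div -!FM !frac_derivE ?mulf_neq0 // !mulf_div -!FM.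
rewrite addf_div ?F_neq0 ?mulf_neq0 // -!FM -FD.
apply/eqP; rewrite eqr_div ?F_neq0 ?mulf_neq0 // -!FM; apply/eqP.
by congr (_%:F); rewrite !mderivM; ring.
Qed.

Lemma frac_deriv_poly (a : S) : frac_deriv a%:F = (a^`M(i))%:F.
Proof.
have := @frac_derivE a 1 (oner_neq0 _); rewrite tofrac1 divr1 => ->.
by rewrite -mpolyC1 mderivC mulr0 subr0 !mulr1 tofrac1 divr1.
Qed.

End FractionDerivative.

(* All that is used of the homogeneous prime of a point, or of its image under f. *)
Record localizing (Q : S -> Prop) : Prop := Localizing {
  localizing0 : Q 0;
  localizing_prime : forall a b, Q (a * b) -> Q a \/ Q b;
  localizing1 : ~ Q 1 }.

Section LocalRing.

Variable Q : S -> Prop.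
Hypothesis locQ : localizing Q.

Lemma loc_neq0 b : ~ Q b -> b != 0.
Proof. by move=> nQ; apply/eqP => b0; apply: nQ; rewrite b0; case: locQ. Qed.

Lemma locM a b : ~ Q a -> ~ Q b -> ~ Q (a * b).
Proof. by move=> na nb /(localizing_prime locQ) []. Qed.

Lemma locX a m : ~ Q a -> ~ Q (a ^+ m).
Proof.
move=> na; elim: m => [|m IH]; first by rewrite expr0; case: locQ.
by rewrite exprS; apply: locM.
Qed.

Lemma local_ring_frac m (a b : S) :
  a \is m.-homog -> b \is m.-homog -> ~ Q b -> local_ring Q (a%:F / b%:F).
Proof. by move=> am bm nb; exists a, b, m. Qed.

Lemma local_ringC c : local_ring Q (c%:MP)%:F.
Proof.
exists c%:MP, 1, 0%N; rewrite tofrac1 divr1; split=> //; last by case: locQ.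
  by rewrite -alg_mpolyC; apply: dhomogZ; exact: dhomog1.
exact: dhomog1.
Qed.

Lemma local_ringD s t : local_ring Q s -> local_ring Q t -> local_ring Q (s + t).
Proof.
move=> [a [b [m [am bm nb ->]]]] [c [d [l [cl dl nd ->]]]].
rewrite addf_div ?F_neq0 ?loc_neq0 // -!FM -FD.
apply: (@local_ring_frac (m + l)); [|exact: dhomogM|exact: locM].
by apply: rpredD; [exact: dhomogM|rewrite addnC; exact: dhomogM].
Qed.

Lemma local_ringM s t : local_ring Q s -> local_ring Q t -> local_ring Q (s * t).
Proof.
move=> [a [b [m [am bm nb ->]]]] [c [d [l [cl dl nd ->]]]].
rewrite mulf_div -!FM.
by apply: (@local_ring_frac (m + l)); [exact: dhomogM|exact: dhomogM|exact: locM].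
Qed.

Lemma local_ring1 : local_ring Q 1.
Proof. by rewrite -tofrac1 -mpolyC1; exact: local_ringC. Qed.

Lemma local_ring0 : local_ring Q 0.
Proof. by rewrite -tofrac0 -mpolyC0; exact: local_ringC. Qed.

Lemma local_ringN s : local_ring Q s -> local_ring Q (- s).
Proof.
move=> sQ; rewrite -mulN1r; apply: local_ringM => //.
by rewrite -tofrac1 -tofracN -mpolyC1 -mpolyCN; exact: local_ringC.
Qed.

Lemma local_ringX s m : local_ring Q s -> local_ring Q (s ^+ m).
Proof.
move=> sQ; elim: m => [|m IH]; first by rewrite expr0; exact: local_ring1.
by rewrite exprS; apply: local_ringM.
Qed.

Lemma local_ring_sum (I : Type) (r : seq I) (P : pred I) (f : I -> K) :
  (forall j, P j -> local_ring Q (f j)) -> local_ring Q (\sum_(j <- r | P j) f j).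
Proof. by move=> fQ; apply: big_ind => //; [exact: local_ring0|exact: local_ringD]. Qed.

Lemma local_ring_prod (I : Type) (r : seq I) (P : pred I) (f : I -> K) :
  (forall j, P j -> local_ring Q (f j)) -> local_ring Q (\prod_(j <- r | P j) f j).
Proof. by move=> fQ; apply: big_ind => //; [exact: local_ring1|exact: local_ringM]. Qed.

Lemma local_ring_det m (M : 'M[K]_m) :
  (forall i j, local_ring Q (M i j)) -> local_ring Q (\det M).
Proof.
move=> MQ; apply: local_ring_sum => s _; apply: local_ringM; last exact: local_ring_prod.
by apply/local_ringX/local_ringN; exact: local_ring1.
Qed.

Section Frame.

Variable i : 'I_n.+1.
Hypothesis nQi : ~ Q 'X_i.

Let Xi0 : ('X_i : S)%:F != 0. Proof. exact/F_neq0/loc_neq0. Qed.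

(* The partial derivative with respect to the affine coordinate x_(lift i j) / x_i. *)
Definition coord_deriv (j : 'I_n) (s : K) : K := ('X_i)%:F * frac_deriv (lift i j) s.

Definition coordinate (j : 'I_n) : K := ('X_(lift i j))%:F / ('X_i)%:F.

Lemma coordinate_local j : local_ring Q (coordinate j).
Proof. by apply: (@local_ring_frac 1); rewrite ?homogX. Qed.

Lemma coord_deriv_coordinate l j : coord_deriv l (coordinate j) = (l == j)%:R.
Proof.
rewrite /coord_deriv frac_derivE ?loc_neq0 // !mderivXi (inj_eq lift_inj).
rewrite [lift i l == i]eq_sym (negPf (neq_lift _ _)) mulr0 subr0 [X in X / _]FM FM mulrA.
rewrite mulrCA mulfK ?mulf_neq0 //.
by case: (l == j); rewrite (tofrac1, tofrac0).
Qed.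

(** The factor x_i restores the degree lost by differentiation, and the new denominator b^2 is still
    outside [Q]. *)
Lemma coord_deriv_derivation j : derivation Q (coord_deriv j).
Proof.
split.
- move=> _ [a [b [m [am bm nb ->]]]]; rewrite /coord_deriv frac_derivE ?loc_neq0 // mulrA -FM.
  case: m am bm => [|m] am bm.
    rewrite !mderiv_homog0 // mul0r mulr0 subr0 mulr0 tofrac0 mul0r; exact: local_ring0.
  apply: (@local_ring_frac (m.+1 + m.+1)); [|exact: dhomogM|exact: locM].
  have -> : (m.+1 + m.+1 = 1 + (m + m.+1))%N by rewrite addSn add1n.
  apply: dhomogM; first exact: homogX.
  apply: rpredB; first by apply: dhomogM => //; apply: mderiv_homog.
  by rewrite addnC; apply: dhomogM => //; apply: mderiv_homog.
- by move=> s t _ _; rewrite /coord_deriv frac_derivD mulrDr.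
- by move=> s t _ _; rewrite /coord_deriv frac_derivM; ring.
- by move=> c; rewrite /coord_deriv frac_deriv_poly mderivC tofrac0 mulr0.
Qed.

(** The difference [E] of the two sides is a derivation killing constants and coordinates, hence
    every a / x_i^m. For s = a/b, the product of s with b / x_i^m is such an element, so (b / x_i^m)
    [E s] = 0. *)
Lemma derivation_coord D s : derivation Q D -> local_ring Q s ->
  D s = \sum_j D (coordinate j) * coord_deriv j s.
Proof.
move=> [DQ DA DM DC] sQ.
pose E t := D t - \sum_j D (coordinate j) * coord_deriv j t.
have eQ j t : local_ring Q t -> local_ring Q (coord_deriv j t).
  by case: (coord_deriv_derivation j) => H _ _ _; exact: H.
have EA t u : local_ring Q t -> local_ring Q u -> E (t + u) = E t + E u.
  move=> tQ uQ; rewrite /E DA //.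
  under eq_bigr => j _.
    by case: (coord_deriv_derivation j) => _ -> // _ _; rewrite mulrDr; over.
  by rewrite big_split /= opprD addrACA.
have EM t u : local_ring Q t -> local_ring Q u -> E (t * u) = t * E u + u * E t.
  move=> tQ uQ; rewrite /E DM //.
  under eq_bigr => j _.
    case: (coord_deriv_derivation j) => _ _ -> // _; rewrite mulrDr.
    by rewrite mulrCA [X in _ + X]mulrCA; over.
  by rewrite big_split /= -!mulr_sumr; ring.
have EC c : E (c%:MP)%:F = 0.
  rewrite /E DC big1 ?subr0 // => j _.
  by case: (coord_deriv_derivation j) => _ _ _ ->; rewrite mulr0.
have Ez j : E (coordinate j) = 0.
  rewrite /E (bigD1 j) //= coord_deriv_coordinate eqxx mulr1 big1 ?addr0 ?subrr // => l lj.
  by rewrite coord_deriv_coordinate (negPf lj) mulr0.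
pose V t := local_ring Q t /\ E t = 0.
have VC c : V (c%:MP)%:F by split; [exact: local_ringC|exact: EC].
have V1 : V 1 by rewrite -tofrac1 -mpolyC1; exact: VC.
have V0 : V 0 by rewrite -tofrac0 -mpolyC0; exact: VC.
have VD t u : V t -> V u -> V (t + u).
  by move=> [tQ Et] [uQ Eu]; split; [exact: local_ringD|rewrite EA // Et Eu addr0].
have VM t u : V t -> V u -> V (t * u).
  by move=> [tQ Et] [uQ Eu]; split; [exact: local_ringM|rewrite EM // Et Eu !mulr0 addr0].
have VX t l : V t -> V (t ^+ l).
  by move=> Vt; elim: l => [|l IH]; rewrite ?exprS ?expr0 //; exact: VM.
have Vratio j : V (('X_j)%:F / ('X_i)%:F).
  case: (unliftP i j) => [l|] ->; last by rewrite divff.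
  by split; [exact: coordinate_local|exact: Ez].
have Vhomog m (a : S) : a \is m.-homog -> V (a%:F / ('X_i ^+ m)%:F).
  move=> am; rewrite (mpolyE a) (raddf_sum (@FracField.tofrac S)) /= mulr_suml big_seq.
  apply: (big_ind V V0 VD) => q qa; rewrite -mul_mpolyC FM -mulrA; apply: (VM); first exact: VC.
  have <- : mdeg q = m by exact: (dhomog_mf am).
  rewrite mpolyXE_id mdegE -prodrXr !(rmorph_prod (@FracField.tofrac S)) /= -prodf_div.
  by apply: (big_ind V V1 VM) => j _; rewrite !tofracXn -expr_div_n; exact: VX.
apply/eqP; rewrite -subr_eq0 -/(E s); apply/eqP.
have [a [b [m [am bm nb Es]]]] := sQ.
have Xm0 : ('X_i ^+ m)%:F != 0 by apply: F_neq0; rewrite expf_neq0 // loc_neq0.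
have [bQ Eb] := Vhomog _ _ bm; have [_ Ea] := Vhomog _ _ am.
have bF0 : b%:F != 0 := F_neq0 (loc_neq0 nb).
have b0 : b%:F / ('X_i ^+ m)%:F != 0 := mulf_neq0 bF0 (invr_neq0 Xm0).
apply: (mulfI b0); rewrite mulr0 -Ea.
have <- : s * (b%:F / ('X_i ^+ m)%:F) = a%:F / ('X_i ^+ m)%:F.
  by rewrite Es mulrA (divfK bF0).
by rewrite (EM _ _ sQ bQ) Eb mulr0 add0r.
Qed.

Lemma coord_frame : tangent_frame Q coord_deriv.
Proof.
split=> [j|D DD]; first exact: coord_deriv_derivation.
exists (\row_j D (coordinate j)); split.
  split=> [j|s sQ].
    by rewrite mxE; case: DD => DQ _ _ _; apply/DQ/coordinate_local.
  by rewrite (derivation_coord DD sQ); apply: eq_bigr => j _; rewrite mxE.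
move=> c [cQ cD]; apply/rowP => j; rewrite mxE cD; last exact: coordinate_local.
rewrite (bigD1 j) //= coord_deriv_coordinate eqxx mulr1 big1 ?addr0 // => l lj.
by rewrite coord_deriv_coordinate (negPf lj) mulr0.
Qed.

(** [C] expresses the coordinate derivations in the frame [e]; evaluating at the coordinates gives
    the identity. This controls the determinant under a change of frame. *)
Lemma frame_matrix_inverse e : tangent_frame Q e ->
  exists2 C : 'M[K]_n, (forall a b, local_ring Q (C a b)) &
    C *m (\matrix_(a, b) e a (coordinate b)) = 1%:M.
Proof.
move=> [_ eQ].
have exC a : exists c : 'rV[K]_n, (forall b, local_ring Q (c 0 b)) /\
    (forall s, local_ring Q s -> coord_deriv a s = \sum_b c 0 b * e b s).
  by have [c [cP _]] := eQ _ (coord_deriv_derivation a); exists c.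
pose c a := projT1 (boolp.cid (exC a)).
have cP a : (forall b, local_ring Q (c a 0 b)) /\
    (forall s, local_ring Q s -> coord_deriv a s = \sum_b c a 0 b * e b s).
  exact: projT2 (boolp.cid (exC a)).
exists (\matrix_(a, b) c a 0 b) => [a b|]; first by rewrite mxE; case: (cP a).
apply/matrixP => a b; rewrite !mxE -coord_deriv_coordinate.
have [_ ->] := cP a; last exact: coordinate_local.
by apply: eq_bigr => j _; rewrite !mxE.
Qed.

End Frame.
End LocalRing.
End LocalGeometry.

(** * The stalks of the critical ideal *)

(* Clearing row i of N outside column l by column operations. *)
Lemma det_condensation (R : comNzRingType) n (N : 'M[R]_n.+1) (i l : 'I_n.+1) :
  N i l ^+ n * \det N = N i l * ((-1) ^+ (i + l) * \det (\matrix_(a, b)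
    (N i l * N (lift i a) (lift l b) - N i (lift l b) * N (lift i a) l))).
Proof.
pose T : 'M[R]_n.+1 := \matrix_(c, b) if b == l then (c == l)%:R
  else if c == l then - N i b else (c == b)%:R * N i l.
have detT : \det T = N i l ^+ n.
  rewrite (expand_det_col _ l) (bigD1 l) //= big1 ?addr0 => [|c cl]; last first.
    by rewrite mxE eqxx (negPf cl) mul0r.
  rewrite mxE !eqxx mul1r /cofactor -signr_odd oddD addbb mul1r -det_scalar.
  congr (\det _); apply/matrixP => a b; rewrite !mxE.
  rewrite [lift l b == l]eq_sym [lift l a == l]eq_sym !(negPf (neq_lift _ _)).
  by rewrite (inj_eq lift_inj); case: eqP => _; rewrite ?mul1r ?mul0r.
have NT a b : (N *m T) a b = if b == l then N a l else N i l * N a b - N i b * N a l.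
  rewrite mxE (bigD1 l) //= mxE eqxx; case: (eqVneq b l) => [->|bl].
    by rewrite mulr1 big1 ?addr0 // => c cl; rewrite mxE eqxx (negPf cl) mulr0.
  rewrite (bigD1 b) //= mxE (negPf bl) eqxx mul1r big1 => [|c /andP[cl cb]].
    by rewrite addr0; ring.
  by rewrite mxE (negPf bl) (negPf cl) (negPf cb) mul0r mulr0.
rewrite -detT mulrC -det_mulmx (expand_det_row _ i) (bigD1 l) //= big1 => [|b bl]; last first.
  by rewrite NT (negPf bl) [X in X - _]mulrC subrr mul0r.
rewrite addr0 NT eqxx; congr (_ * (_ * \det _)); apply/matrixP => a b.
by rewrite mxE mxE NT [lift l b == l]eq_sym (negPf (neq_lift _ _)) mxE.
Qed.

Lemma mpoly_ring_ind (R : comNzRingType) n (T : {mpoly R[n]} -> Prop) :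
  (forall c, T c%:MP) -> (forall i, T 'X_i) ->
  (forall g h, T g -> T h -> T (g + h)) -> (forall g h, T g -> T h -> T (g * h)) ->
  forall g, T g.
Proof.
move=> TC TX TD TM; have T0 : T 0 by rewrite -mpolyC0.
have T1 : T 1 by rewrite -mpolyC1.
move=> g; rewrite (mpolyE g); apply: (big_ind T T0 TD) => m _.
rewrite -mul_mpolyC mpolyXE_id; apply: (TM) => //; apply: (big_ind T T1 TM) => i _.
by elim: (m i) => [|l IH]; rewrite ?expr0 ?exprS //; apply: TM.
Qed.

Lemma mderiv_comp (R : comNzRingType) n r (F : n.-tuple {mpoly R[r]}) a (g : {mpoly R[n]}) :
  (g \mPo F)^`M(a) = \sum_j (g^`M(j) \mPo F) * (tnth F j)^`M(a).
Proof.
elim/mpoly_ring_ind: g => [c|i|g h IHg IHh|g h IHg IHh].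
- by rewrite comp_mpolyC mderivC big1 // => j _; rewrite mderivC comp_mpoly0 mul0r.
- rewrite (bigD1 i) //= mderivXi eqxx rmorph1 mul1r big1 ?addr0 => [|j ji].
    by rewrite comp_mpolyXU -tnth_nth.
  by rewrite mderivXi (negPf ji) rmorph0 mul0r.
- rewrite rmorphD mderivD IHg IHh -big_split; apply: eq_bigr => j _ /=.
  by rewrite mderivD rmorphD mulrDl.
rewrite rmorphM mderivM IHg IHh mulr_suml mulr_sumr -big_split; apply: eq_bigr => j _ /=.
by rewrite mderivM rmorphD !rmorphM /=; ring.
Qed.

Lemma comp_homog (R : comNzRingType) n r d m (F : n.-tuple {mpoly R[r]}) (g : {mpoly R[n]}) :
  (forall i, tnth F i \is d.-homog) -> g \is m.-homog -> g \mPo F \is (m * d).-homog.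
Proof.
move=> Fd gm; rewrite comp_mpolyE big_seq; apply: rpred_sum => q qg; apply: dhomogZ.
have <- : mdeg q = m by exact: (dhomog_mf gm).
rewrite mdegE big_distrl /=; elim/big_rec2: _ => [|i y1 y2 _ IH]; first exact: dhomog1.
by apply: dhomogM => //; rewrite mulnC; apply: dhomogMn.
Qed.

Section CriticalIdeal.

Variables (n : nat) (k : closedFieldType) (d : nat).
Hypotheses (d_gt0 : (0 < d)%N) (d_neq0 : d%:R != 0 :> k).

Local Notation S := {mpoly k[n.+1]}.
Local Notation K := {fraction S}.
Local Notation "g '%:F'" := (FracField.tofrac g : K) (at level 1, format "g %:F").

Variable F : n.+1.-tuple S.
Hypothesis F_homog : forall i, tnth F i \is d.-homog.

Let FM (a b : S) : (a * b)%:F = a%:F * b%:F. Proof. exact: tofracM. Qed.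
Let F_neq0 (a : S) : a != 0 -> a%:F != 0. Proof. by rewrite tofrac_eq0. Qed.

Variable P : proj_point n k.

Lemma proj_point_localizing : localizing P.
Proof. by case: (proj_point_prime P). Qed.

Lemma image_localizing : localizing (image_point F P).
Proof.
rewrite /image_point; split; first by rewrite comp_mpoly0; exact: prime_of0.
  by move=> a b; rewrite rmorphM; exact: prime_of_prime.
by rewrite rmorph1; case: proj_point_localizing.
Qed.

Local Notation locP := proj_point_localizing.
Local Notation locfP := image_localizing.

Let comp_neq0 b : ~ image_point F P b -> b \mPo F != 0.
Proof. exact: (loc_neq0 locP). Qed.

Lemma pullback_fun s t t' : pullback F P s t -> pullback F P s t' -> t = t'.
Proof.
move=> [a [b [m [_ _ nb -> ->]]]] [a' [b' [m' [_ _ nb' /eqP E ->]]]].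
have [b0 b'0] := (loc_neq0 locfP nb, loc_neq0 locfP nb').
have [c0 c'0] := (comp_neq0 nb, comp_neq0 nb').
move: E; rewrite (frac_eq _ _ b0 b'0) => /eqP E.
by apply/eqP; rewrite (frac_eq _ _ c0 c'0) -!rmorphM /= E.
Qed.

Lemma pullback_local s t : pullback F P s t -> local_ring P t.
Proof.
move=> [a [b [m [am bm nb _ ->]]]].
by apply: (@local_ring_frac _ _ _ (m * d)); rewrite ?comp_homog.
Qed.

Lemma pullback_exists s : local_ring (image_point F P) s -> exists t, pullback F P s t.
Proof.
move=> [a [b [m [am bm nb ->]]]].
by exists ((a \mPo F)%:F / (b \mPo F)%:F), a, b, m.
Qed.

Lemma pullbackD s t s' t' :
  pullback F P s t -> pullback F P s' t' -> pullback F P (s + s') (t + t').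
Proof.
move=> [a [b [m [am bm nb -> ->]]]] [a' [b' [m' [am' bm' nb' -> ->]]]].
have [b0 b'0] := (loc_neq0 locfP nb, loc_neq0 locfP nb').
have [c0 c'0] := (comp_neq0 nb, comp_neq0 nb').
exists (a * b' + a' * b), (b * b'), (m + m')%N; split.
- by apply: rpredD; [exact: dhomogM|rewrite addnC; exact: dhomogM].
- exact: dhomogM.
- exact: (locM locfP).
- by rewrite (frac_add _ _ b0 b'0).
have compD : (a * b' + a' * b) \mPo F = (a \mPo F) * (b' \mPo F) + (a' \mPo F) * (b \mPo F).
  by rewrite comp_mpolyD !rmorphM.
have compM : (b * b') \mPo F = (b \mPo F) * (b' \mPo F) by rewrite rmorphM.
by rewrite compD compM (frac_add _ _ c0 c'0).
Qed.

Lemma pullbackM s t s' t' :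
  pullback F P s t -> pullback F P s' t' -> pullback F P (s * s') (t * t').
Proof.
move=> [a [b [m [am bm nb -> ->]]]] [a' [b' [m' [am' bm' nb' -> ->]]]].
exists (a * a'), (b * b'), (m + m')%N; split.
- exact: dhomogM.
- exact: dhomogM.
- exact: (locM locfP).
- by rewrite frac_mul.
have compM g h : (g * h) \mPo F = (g \mPo F) * (h \mPo F) by rewrite rmorphM.
by rewrite !compM frac_mul.
Qed.

Lemma pullbackC c : pullback F P (c%:MP)%:F (c%:MP)%:F.
Proof.
exists c%:MP, 1, 0%N; rewrite comp_mpolyC comp_mpoly1 tofrac1 divr1; split=> //.
- by rewrite -alg_mpolyC; apply: dhomogZ; exact: dhomog1.
- exact: dhomog1.
by case: locfP.
Qed.

Lemma pullback_sum (I : finType) (s t : I -> K) :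
  (forall j, pullback F P (s j) (t j)) -> pullback F P (\sum_j s j) (\sum_j t j).
Proof.
move=> st; elim/big_rec2: _ => [|j u v _]; last exact: pullbackD.
by rewrite -tofrac0 -mpolyC0; exact: pullbackC.
Qed.

Section Chart.

Variables (i l : 'I_n.+1).
Hypotheses (nPi : ~ P 'X_i) (nPl : ~ P (tnth F l)).

Let nfPl : ~ image_point F P 'X_l.
Proof. by rewrite /image_point comp_mpolyXU -tnth_nth. Qed.

Let Xi0 : ('X_i : S) != 0. Proof. exact: (loc_neq0 locP nPi). Qed.
Let Fl0 : tnth F l != 0. Proof. exact: (loc_neq0 locP nPl). Qed.

(* The pullback by f of the affine coordinate y_(lift l j) / y_l. *)
Definition target (j : 'I_n) : K := (tnth F (lift l j))%:F / (tnth F l)%:F.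

Definition affine_jacobian : 'M[K]_n := \matrix_(a, j) coord_deriv i a (target j).

Definition critical_generator : K :=
  (\det (jacobian (tnth F)))%:F / ('X_i ^+ (n.+1 * d.-1))%:F.

Lemma pullback_coordinate j : pullback F P (coordinate k l j) (target j).
Proof.
exists 'X_(lift l j), 'X_l, 1%N; rewrite !comp_mpolyXU -!tnth_nth.
by split=> //; exact: homogX.
Qed.

Lemma target_local j : local_ring P (target j).
Proof. exact: pullback_local (pullback_coordinate j). Qed.

Lemma affine_jacobian_local a j : local_ring P (affine_jacobian a j).
Proof.
by rewrite mxE; case: (coord_deriv_derivation locP i a) => H _ _ _; apply/H/target_local.
Qed.

(** The numerators of the quotient rule for the derivatives of F_j / F_l, which are also the entries
    produced by [det_condensation]. *)
Let condensed : 'M[S]_n := \matrix_(a, b)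
  (tnth F l * (tnth F (lift l b))^`M(lift i a) - tnth F (lift l b) * (tnth F l)^`M(lift i a)).

Let det_condensed :
  tnth F l ^+ n * ('X_i * \det (jacobian (tnth F))) =
    d%:R * (tnth F l * ((-1) ^+ (i + l) * \det condensed)).
Proof.
rewrite (euler_det i F_homog) mulrCA.
set N := \matrix_(a, b) _; have Nil : N i l = tnth F l by rewrite mxE eqxx.
rewrite -Nil det_condensation; congr (_ * (_ * (_ * \det _))).
apply/matrixP => a b; rewrite !mxE eqxx.
by rewrite ![lift i a == i]eq_sym (negPf (neq_lift _ _)).
Qed.

Let affine_condensed :
  affine_jacobian = (('X_i)%:F / (tnth F l)%:F ^+ 2) *: map_mx (@FracField.tofrac S) condensed.
Proof.
apply/matrixP => a b; rewrite !mxE /coord_deriv frac_derivE // FM -expr2.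
rewrite [(tnth F (lift l b))^`M(lift i a) * _]mulrC.
by rewrite mulrA mulrAC.
Qed.

Let field_identity (L : fieldType) (f x J c s w : L) : f != 0 -> s * s = 1 ->
  f ^+ n * (x * J) = c * (f * (s * w)) ->
  c * f ^+ n.+1 * ((x / f ^+ 2) ^+ n * w) = s * (x ^+ n.+1 * J).
Proof.
move=> f0 ss E.
have fn0 : f ^+ n != 0 by rewrite expf_neq0.
apply: (mulfI fn0); rewrite [RHS](_ : _ = s * x ^+ n * (f ^+ n * (x * J))); last first.
  by rewrite exprS; ring.
rewrite E expr_div_n -exprM mul2n -addnn exprD exprS.
rewrite (_ : s * x ^+ n * _ = (s * s) * (x ^+ n * c * f * w)); last by ring.
by rewrite ss; field.
Qed.

Let unit_identity (L : fieldType) (s c c' r r' : L) m :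
  (s * c' * r ^+ m) * (s * c * r' ^+ m) = (s * s) * (c * c') * (r * r') ^+ m.
Proof. by rewrite exprMn; ring. Qed.

Let generator_identity (L : fieldType) (f x J c c' s D : L) m : f != 0 -> x != 0 ->
  c * c' = 1 -> c * f ^+ m.+1 * D = s * (x ^+ m.+1 * J) ->
  D = s * c' * (x ^+ d / f) ^+ m.+1 * (J / x ^+ (m.+1 * d.-1)).
Proof.
move=> f0 x0 cc' E; have c0 : c != 0.
  by apply/eqP => c0; move/eqP: cc'; rewrite c0 mul0r eq_sym oner_eq0.
have fm0 : f ^+ m.+1 != 0 by rewrite expf_neq0.
apply: (mulfI (mulf_neq0 c0 fm0)); rewrite E expr_div_n -exprM.
rewrite (_ : c * f ^+ m.+1 * _ = s * (c * c') * (x ^+ (d * m.+1) / x ^+ (m.+1 * d.-1)) * J *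
  (f ^+ m.+1 / f ^+ m.+1)); last by ring.
rewrite cc' divff // !mulr1 -mulrA; congr (_ * (_ * _)).
rewrite mulnC -{1}(prednK d_gt0) mulnS exprD mulfK // expf_neq0 //.
Qed.

(** Here u is d^(-1) (x_i^d / F_l)^(n+1) up to sign, a unit because neither x_i nor F_l vanishes at
    P and d is nonzero in k. *)
Lemma det_affine_jacobian : exists u v : K,
  [/\ local_ring P u, local_ring P v, u * v = 1 & \det affine_jacobian = u * critical_generator].
Proof.
pose c : K := (d%:R%:MP)%:F; pose c' : K := (d%:R^-1%:MP)%:F.
have cc' : c * c' = 1 by rewrite -FM -mpolyCM mulfV // mpolyC1 tofrac1.
pose s : K := (-1) ^+ (i + l).
have ss : s * s = 1 by rewrite -exprD addnn -mul2n exprM sqrrN expr1n expr1n.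
have sQ : local_ring P s.
  by apply: local_ringX; [exact: locP|]; apply: local_ringN; [exact: locP|];
     apply: local_ring1; exact: locP.
pose r : K := ('X_i ^+ d)%:F / (tnth F l)%:F; pose r' : K := (tnth F l)%:F / ('X_i ^+ d)%:F.
have Xd0 : ('X_i ^+ d : S) != 0 by rewrite expf_neq0.
have rr' : r * r' = 1 by rewrite /r /r' mulf_div [X in X / _]mulrC divff // mulf_neq0 ?F_neq0.
have rQ : local_ring P r by apply: (@local_ring_frac _ _ _ d); rewrite ?homogXn.
have r'Q : local_ring P r'.
  by apply: (@local_ring_frac _ _ _ d); rewrite ?homogXn //; exact: (locX locP).
exists (s * c' * r ^+ n.+1), (s * c * r' ^+ n.+1); split.
- apply: (local_ringM locP); last exact: (local_ringX locP).
  by apply: (local_ringM locP) => //; exact: (local_ringC locP).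
- apply: (local_ringM locP); last exact: (local_ringX locP).
  by apply: (local_ringM locP) => //; exact: (local_ringC locP).
- by rewrite unit_identity ss cc' rr' expr1n !mulr1.
have f0 : (tnth F l)%:F != 0 := F_neq0 Fl0.
have x0 : ('X_i : S)%:F != 0 := F_neq0 Xi0.
have E : (tnth F l)%:F ^+ n * (('X_i)%:F * (\det (jacobian (tnth F)))%:F) =
    c * ((tnth F l)%:F * (s * (\det condensed)%:F)).
  have := congr1 (@FracField.tofrac S) det_condensed.
  by rewrite !tofracM !tofracXn tofracN tofrac1 /c mpolyC_nat.
have := field_identity f0 ss E.
rewrite -det_map_mx -detZ -affine_condensed => /(generator_identity f0 x0 cc') ->.
by rewrite /critical_generator /r !tofracXn.
Qed.

Let represents_identity (L : fieldType) (x A w f h : L) : f != 0 ->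
  x * (A * w / (f * (h * h))) = x / f ^+ 2 * A * (f * w / (h * h)).
Proof. by move=> f0; rewrite invfM; move: (h * h)^-1 => h'; field. Qed.

(* The chain rule in the coordinates of the two charts. *)
Lemma affine_jacobian_represents :
  represents_differential F P (coord_deriv i) (coord_deriv l) affine_jacobian.
Proof.
split=> [|s t u st su a]; first exact: affine_jacobian_local.
have [g [h [m [gm hm nh Es Et]]]] := st.
have h0 : h != 0 := loc_neq0 locfP nh.
have ch0 : h \mPo F != 0 := comp_neq0 nh.
pose W j : S := (g^`M(j) \mPo F) * (h \mPo F) - (g \mPo F) * (h^`M(j) \mPo F).
pose cd j : S := g^`M(j) * h - g * h^`M(j).
have cdW j : cd j \mPo F = W j by rewrite /cd /W rmorphB !rmorphM.
have uE j : u j = (tnth F l * W (lift l j))%:F / ((h \mPo F) * (h \mPo F))%:F.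
  apply: (pullback_fun (su j)).
  have -> : coord_deriv l j s = ('X_l * cd (lift l j))%:F / (h * h)%:F.
    by rewrite /coord_deriv Es (frac_derivE _ _ h0) mulrA -FM.
  have homog_cd : 'X_l * cd (lift l j) \is (m + m).-homog.
    case: m gm hm => [|m] gm hm.
      by rewrite /cd !mderiv_homog0 // mul0r mulr0 subr0 mulr0 rpred0.
    have -> : (m.+1 + m.+1 = 1 + (m + m.+1))%N by rewrite addSn add1n.
    apply: dhomogM; first exact: homogX.
    apply: rpredB; first by apply: dhomogM => //; apply: mderiv_homog.
    by rewrite addnC; apply: dhomogM => //; apply: mderiv_homog.
  exists ('X_l * cd (lift l j)), (h * h), (m + m)%N; split=> //.
  - exact: dhomogM.
  - exact: (locM locfP).
  have compX : 'X_l \mPo F = tnth F l by rewrite comp_mpolyXU -tnth_nth.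
  by rewrite !rmorphM /= cdW compX.
(* Since g and h have the same degree, the Euler relations of the two cancel. This relation removes
   the derivative in direction l, which has no affine coordinate. *)
have eulerW : \sum_j tnth F j * W j = 0.
  have eg := congr1 (fun q => q \mPo F) (euler gm).
  have eh := congr1 (fun q => q \mPo F) (euler hm).
  have E q : (\sum_j 'X_j * q^`M(j)) \mPo F = \sum_j tnth F j * (q^`M(j) \mPo F).
    rewrite rmorph_sum; apply: eq_bigr => j _ /=.
    by rewrite rmorphM /= comp_mpolyXU -tnth_nth.
  rewrite E rmorphM rmorph_nat /= in eg; rewrite E rmorphM rmorph_nat /= in eh.
  transitivity ((\sum_j tnth F j * (g^`M(j) \mPo F)) * (h \mPo F) -
                (\sum_j tnth F j * (h^`M(j) \mPo F)) * (g \mPo F)).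
    rewrite !mulr_suml -sumrB; apply: eq_bigr => j _; rewrite /W; ring.
  by rewrite eg eh; ring.
have derivW : (g \mPo F)^`M(lift i a) * (h \mPo F) - (g \mPo F) * (h \mPo F)^`M(lift i a) =
    \sum_j W j * (tnth F j)^`M(lift i a).
  by rewrite !mderiv_comp mulr_suml mulr_sumr -sumrB; apply: eq_bigr => j _; rewrite /W; ring.
have cond : tnth F l * (\sum_j W j * (tnth F j)^`M(lift i a)) =
    \sum_(j < n) condensed a j * W (lift l j).
  transitivity (\sum_j (tnth F l * (tnth F j)^`M(lift i a) -
      tnth F j * (tnth F l)^`M(lift i a)) * W j).
    transitivity (tnth F l * (\sum_j W j * (tnth F j)^`M(lift i a)) -
        (tnth F l)^`M(lift i a) * \sum_j tnth F j * W j); first by rewrite eulerW mulr0 subr0.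
    by rewrite !mulr_sumr -sumrB; apply: eq_bigr => j _; ring.
  rewrite (bigD1_ord l) //= subrr mul0r add0r.
  by apply: eq_bigr => j _; rewrite mxE.
rewrite Et /coord_deriv (frac_derivE _ _ ch0) derivW.
transitivity (('X_i)%:F * ((tnth F l * \sum_j W j * (tnth F j)^`M(lift i a))%:F /
  (tnth F l * ((h \mPo F) * (h \mPo F)))%:F)).
  congr (_ * _); apply/eqP; rewrite frac_eq ?mulf_neq0 //; apply/eqP; ring.
rewrite cond (raddf_sum (@FracField.tofrac S)) /= mulr_suml mulr_sumr; apply: eq_bigr => j _.
rewrite affine_condensed uE !mxE.
have f0 : (tnth F l)%:F != 0 := F_neq0 Fl0.
by rewrite !FM; exact: represents_identity.
Qed.

(** For arbitrary frames, evaluation on coordinates gives M U = C T, where T is [affine_jacobian]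
    and U, C are the matrices of the frames. The pulled-back matrix V' is a left inverse of U, so
    det M is a local multiple of det T. The converse uses the coordinate frames themselves. *)
Lemma critical_idealP s :
  critical_ideal F P s <-> exists a, local_ring P a /\ s = a * critical_generator.
Proof.
have [u [v [uQ vQ uv detT]]] := det_affine_jacobian.
split=> [[e [eps [M [a [eF epsF [MQ Mrep] aQ ->]]]]]|[a [aQ ->]]]; last first.
  exists (coord_deriv i), (coord_deriv l), affine_jacobian, (a * v); split.
  - exact: (coord_frame locP nPi).
  - exact: (coord_frame locfP nfPl).
  - exact: affine_jacobian_represents.
  - exact: (local_ringM locP).
  by rewrite detT mulrA -[a * v * u]mulrA (mulrC v) uv mulr1.
have [eD _] := eF; have [epsD _] := epsF.
have [V VQ VE] := frame_matrix_inverse locfP nfPl epsF.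
have exU a' b : exists t, pullback F P (eps a' (coordinate k l b)) t.
  apply: pullback_exists; case: (epsD a') => H _ _ _; apply: H.
  exact: (coordinate_local nfPl).
have exV a' b : exists t, pullback F P (V a' b) t by exact: pullback_exists.
pose U : 'M[K]_n := \matrix_(a', b) projT1 (boolp.cid (exU a' b)).
pose V' : 'M[K]_n := \matrix_(a', b) projT1 (boolp.cid (exV a' b)).
have UP a' b : pullback F P (eps a' (coordinate k l b)) (U a' b).
  by rewrite mxE; exact: projT2 (boolp.cid (exU a' b)).
have VP a' b : pullback F P (V a' b) (V' a' b).
  by rewrite mxE; exact: projT2 (boolp.cid (exV a' b)).
clearbody U V'.
have VU : V' *m U = 1%:M.
  apply/matrixP => a' b; apply: (@pullback_fun (1%:M a' b)).
    rewrite -VE !mxE; apply: pullback_sum => c; rewrite mxE.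
    exact: pullbackM.
  rewrite !mxE; case: (a' == b) => /=.
    by rewrite mulr1n -tofrac1 -mpolyC1; exact: pullbackC.
  by rewrite mulr0n -tofrac0 -mpolyC0; exact: pullbackC.
pose C : 'M[K]_n := \matrix_(a', b) e a' (coordinate k i b).
have CQ a' b : local_ring P (C a' b).
  by rewrite mxE; case: (eD a') => H _ _ _; apply: H; exact: (coordinate_local nPi).
have MU : M *m U = C *m affine_jacobian.
  apply/matrixP => a' b; rewrite !mxE.
  rewrite -(Mrep _ _ (fun c => U c b) (pullback_coordinate b) (fun c => UP c b)).
  rewrite (derivation_coord locP nPi (eD a') (target_local b)).
  by apply: eq_bigr => c _; rewrite !mxE.
exists (a * (\det C * \det V' * u)); split.
  apply: (local_ringM locP) => //; apply: (local_ringM locP) => //.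
  apply: (local_ringM locP); apply: (local_ring_det locP) => // a' b.
  exact: (pullback_local (VP a' b)).
have := congr1 determinant MU; rewrite !det_mulmx detT => EM.
have := congr1 determinant VU; rewrite det_mulmx det1 => EV.
have -> : \det M = \det V' * (\det M * \det U) by rewrite mulrCA EV mulr1.
rewrite EM; ring.
Qed.

End Chart.

End CriticalIdeal.

(** * The hypersurface of a prime form *)

Section PrimeHypersurface.

Variables (n : nat) (k : closedFieldType) (N : nat).

Local Notation S := {mpoly k[n.+1]}.
Local Notation K := {fraction S}.
Local Notation "g '%:F'" := (FracField.tofrac g : K) (at level 1, format "g %:F").

Variable J : S.
Hypotheses (N_gt1 : (1 < N)%N) (J_neq0 : J != 0) (J_homog : J \is N.-homog).
Hypothesis J_prime : prime_element J.

Lemma pihomog_mul m (q : S) :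
  pihomog mdeg m (q * J) = if (N <= m)%N then pihomog mdeg (m - N) q * J else 0.
Proof.
transitivity (\sum_(u <- msupp q)
    if (N <= m)%N then pihomog mdeg (m - N) (q@_u *: 'X_[u]) * J else 0); last first.
  by case: ifP => _; [rewrite -mulr_suml -raddf_sum -mpolyE|rewrite big1].
rewrite {1}(mpolyE q) mulr_suml raddf_sum; apply: eq_bigr => u _ /=.
rewrite !linearZ /= -scalerAl linearZ /= pihomogX.
have uJ : 'X_[u] * J \is (mdeg u + N).-homog by rewrite dhomogM ?dhomogX.
have [E|E] := eqVneq (mdeg u + N)%N m.
  by rewrite -{1}E pihomog_dE // -E leq_addl addnK eqxx -scalerAl.
rewrite (pihomog_ne0 E uJ) scaler0; case: leqP => // Nm.
by rewrite -(eqn_add2r N) subnK // (negPf E) scaler0 mul0r.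
Qed.

(** Multiplication by a form of degree N shifts the grading by N, so any quotient may be replaced by
    its component of degree m - N. *)
Lemma homog_quotient m g : g \is m.-homog -> g != 0 -> divides J g ->
  exists q, [/\ q \is (m - N).-homog, q != 0, (N <= m)%N & g = q * J].
Proof.
move=> gm g0 [q E].
have := pihomog_mul m q; rewrite -E pihomog_dE //; case: ifP => Nm Eg; last first.
  by rewrite Eg eqxx in g0.
exists (pihomog mdeg (m - N) q); split=> //; first exact: pihomogP.
by apply: contraNneq g0 => q0; rewrite Eg q0 mul0r.
Qed.

Lemma not_divides_var i : ~ divides J 'X_i.
Proof.
case=> q E; have X0 : ('X_i : S) != 0 by rewrite -msupp_eq0 msuppX.
have q0 : q != 0 by apply: contraNneq X0 => q0; rewrite E q0 mul0r.
have := congr1 (fun g : S => msize g) E; rewrite msizeX mdeg1 msizeM //.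
have mJ : mdeg (mlead J) = N by apply: (dhomog_mf J_homog); rewrite mlead_supp.
rewrite -(mlead_deg J_neq0) -(mlead_deg q0) mJ addSn addnS /= => -[E1].
by move: N_gt1; rewrite ltnNge E1 leq_addl.
Qed.

Lemma generic_point_homog e g : divides J g -> divides J (homog_component e g).
Proof.
case=> q ->; have -> : homog_component e (q * J) = pihomog mdeg e (q * J) by [].
rewrite pihomog_mul; case: ifP => _; last by exists 0; rewrite mul0r.
by exists (pihomog mdeg (e - N) q).
Qed.

(** The principal ideal (J) as a point of the scheme; a degree above 1 keeps the variables out of
    it. *)
Definition generic_point : proj_point n k :=
  @ProjPoint n k (divides J) (ex_intro _ 0 (esym (mul0r J))) (@dividesD _ J)
    (fun g h => @divides_mull _ J h g) J_prime generic_point_homog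
    (ex_intro _ ord0 (@not_divides_var ord0)).

(** The generic point of the whole space: it makes that space irreducible and lies outside the zero
    locus of J. *)
Lemma zero_point_exists : exists P : proj_point n k, forall g, P g <-> g = 0.
Proof.
have D (g h : S) : g = 0 -> h = 0 -> g + h = 0 by move=> -> ->; rewrite addr0.
have M (g h : S) : h = 0 -> g * h = 0 by move=> ->; rewrite mulr0.
have Pr (g h : S) : g * h = 0 -> g = 0 \/ h = 0.
  by move/eqP; rewrite mulf_eq0 => /orP[]/eqP; [left|right].
have H e (g : S) : g = 0 -> homog_component e g = 0.
  by move=> ->; rewrite /homog_component -mpolyC0 msupp0 big_nil.
have R : exists i : 'I_n.+1, ~ ('X_i : S) = 0.
  by exists ord0; apply/eqP; rewrite -msupp_eq0 msuppX.
by exists (@ProjPoint n k (fun g => g = 0) erefl D M Pr H R).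
Qed.

Definition zero_locus (g : S) : proj_point n k -> Prop := fun P => P g.

Lemma zero_locus_closed m g : g \is m.-homog -> Defs.closed (zero_locus g).
Proof.
move=> gm; exists (fun h => h = g); split=> [h ->|P]; first by exists m.
by split=> [Pg h -> //|]; apply.
Qed.

(** A closed set containing the generic point is cut out by multiples of J, hence contains the whole
    zero locus. *)
Lemma zero_locus_irreducible : irreducible (zero_locus J).
Proof.
have PJ : zero_locus J generic_point by exists 1; rewrite mul1r.
split; first by exists generic_point.
move=> A B [E [_ EA]] [E' [_ EB]] cover.
by case: (cover _ PJ) => [/EA H|/EB H]; [left|right] => P PJ';
  [apply/EA|apply/EB] => g /H[q ->]; apply: prime_ofM.
Qed.

Lemma whole_space_closed : Defs.closed (fun _ : proj_point n k => True).
Proof. by exists (fun=> False); split=> // P; split. Qed.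

Lemma whole_space_irreducible : irreducible (fun _ : proj_point n k => True).
Proof.
have [P0 P0P] := zero_point_exists.
split; first by exists P0.
move=> A B [E [_ EA]] [E' [_ EB]] cover.
by case: (cover P0 I) => [/EA H|/EB H]; [left|right] => P _;
  [apply/EA|apply/EB] => g /H/P0P ->; apply: prime_of0.
Qed.

(** In a chain of length 2, [T 1] would be irreducible and strictly larger than the locus. A form
    vanishing on it vanishes at the generic point, so it is q J; irreducibility makes q vanish on
    [T 1], and descent on the degree gives 0. Then [T 1] is the whole space, with nothing above
    it. *)
Lemma zero_locus_codim (W : proj_point n k -> Prop) :
  subset_pts W (zero_locus J) -> subset_pts (zero_locus J) W -> Defs.closed W -> irreducible W ->
  codim W 1.
Proof.
move=> WJ JW Wcl Wirr; split.
  exists (fun i => if i is 0 then W else fun=> True); split.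
  - by split.
  - by case=> [|i] _ //; split; [exact: whole_space_closed|exact: whole_space_irreducible].
  case=> // _; split=> // sub; have [P0 P0P] := zero_point_exists.
  by have /WJ/P0P J0 := sub P0 I; move: J_neq0; rewrite J0 eqxx.
case=> T [[WT TW] Tci Tsub].
have [T1cl T1irr] := Tci 1%N isT; have [T01 nT10] := Tsub 0%N isT.
have [T12 nT21] := Tsub 1%N isT.
have PJ1 : T 1%N generic_point by apply/T01/WT/JW; exists 1; rewrite mul1r.
have vanish r m g : (m <= r)%N -> g \is m.-homog -> subset_pts (T 1%N) (zero_locus g) -> g = 0.
  elim: r m g => [|r IH] m g mr gm Tg; apply/eqP; apply: contraT => g0.
    have [q [_ _ Nm _]] := homog_quotient gm g0 (Tg _ PJ1).
    by move: (leq_trans N_gt1 (leq_trans Nm mr)).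
  have [q [qm q0 Nm Eg]] := homog_quotient gm g0 (Tg _ PJ1).
  have [||P /Tg|Tq|TJ] := T1irr.2 (zero_locus q) (zero_locus J).
  - exact: zero_locus_closed qm.
  - exact: zero_locus_closed J_homog.
  - by rewrite /zero_locus Eg; exact: prime_of_prime.
  - have mNr : (m - N <= r)%N by rewrite leq_subLR (leq_trans mr) // -add1n leq_add2r ltnW.
    by move: q0; rewrite (IH _ _ mNr qm Tq) eqxx.
  by case: nT10 => P /TJ/JW/WT.
case: nT21 => P _; have [E [Eh ET]] := T1cl; apply/ET => g Eg.
have [m gm] := Eh g Eg; rewrite (vanish m m g (leqnn _) gm); first exact: prime_of0.
by move=> Q /ET; apply.
Qed.

Variable I : proj_point n k -> K -> Prop.
Hypothesis I_generated : forall (P : proj_point n k) i, ~ P 'X_i -> forall s,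
  I P s <-> exists a, local_ring P a /\ s = a * (J%:F / ('X_i ^+ N)%:F).

Let F_neq0 (a : S) : a != 0 -> a%:F != 0. Proof. by rewrite tofrac_eq0. Qed.

Let X_neq0 i : ('X_i : S) != 0. Proof. by rewrite -msupp_eq0 msuppX. Qed.

Lemma generated_closed_subscheme : closed_subscheme I.
Proof.
move=> P; have [i nPi] := prime_of_relevant P.
exists 'X_i, 1%N, 1%N, (fun=> J%:F / ('X_i ^+ N)%:F); split=> //; first exact: homogX.
move=> Q nQi; split=> [_|s].
  apply: (@local_ring_frac _ _ _ N) => //; first exact: homogXn.
  exact: (locX (proj_point_localizing Q)).
rewrite (I_generated nQi); split=> [[a [aQ ->]]|[c [cQ ->]]].
  by exists (fun=> a); rewrite big_ord_recl big_ord0 addr0.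
by exists (c ord0); rewrite big_ord_recl big_ord0 addr0.
Qed.

Lemma generated_support P : subscheme_supp I P <-> P J.
Proof.
have [i nPi] := prime_of_relevant P; have locP := proj_point_localizing P.
have nPX : ~ P ('X_i ^+ N) := locX (m := N) locP nPi.
rewrite /subscheme_supp (I_generated nPi); split=> [nI|PJ [_ [[a [b [m [am bm nb ->]]]]]]].
  apply: boolp.contrapT => nPJ; apply: nI.
  exists (('X_i ^+ N)%:F / J%:F); split.
    by apply: (@local_ring_frac _ _ _ N) => //; exact: homogXn.
  by rewrite frac_mul [J * _]mulrC divff // F_neq0 // mulf_neq0 // expf_neq0.
have b0 := loc_neq0 locP nb; have x0 := loc_neq0 locP nPX.
rewrite frac_mul -[LHS](divff (oner_neq0 _)) -tofrac1 => /eqP.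
rewrite (frac_eq _ _ (oner_neq0 _) (mulf_neq0 b0 x0)) mul1r mulr1 => /eqP E.
by apply: (locM locP nb nPX); rewrite E; apply: prime_ofM.
Qed.

(** Clearing denominators shows that J divides a^r times an element outside P. As J lies in P,
    primality gives J dividing a, and the homogeneous quotient exhibits a/b as a multiple of the
    generator. *)
Lemma generated_reduced : reduced I.
Proof.
move=> P /generated_support PJ s r [a [b [m [am bm nb ->]]]].
have [i nPi] := prime_of_relevant P; have locP := proj_point_localizing P.
have nPX : ~ P ('X_i ^+ N) := locX (m := N) locP nPi.
have b0 := loc_neq0 locP nb; have x0 := loc_neq0 locP nPX.
have notJ g : ~ P g -> ~ divides J g by move=> nPg [q E]; apply: nPg; rewrite E; apply: prime_ofM.
rewrite !(I_generated nPi) => -[_ [[u [v [l [ul vl nv ->]]]]]].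
have v0 := loc_neq0 locP nv.
rewrite frac_mul expr_div_n -!tofracXn => /eqP.
rewrite (frac_eq _ _ (expf_neq0 r b0) (mulf_neq0 v0 x0)) => /eqP E.
have Ja : divides J a.
  have : divides J (a ^+ r * (v * 'X_i ^+ N)) by exists (u * b ^+ r); rewrite E; ring.
  case/J_prime => [|/notJ []]; last exact: (locM locP).
  (* Exponent 0 cannot occur: J would divide 1, which is outside P. *)
  elim: r {E} => [|r IH]; first by move/notJ; case; case: locP.
  by rewrite exprS => /J_prime[].
have [a0|a0] := eqVneq a 0.
  by exists 0; rewrite a0 tofrac0 !mul0r; split=> //; exact: local_ring0.
have [q [qm _ Nm Ea]] := homog_quotient am a0 Ja.
exists ((q * 'X_i ^+ N)%:F / b%:F); split.
  apply: (@local_ring_frac _ _ _ m) => //.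
  by rewrite -(subnK Nm); apply: dhomogM => //; exact: homogXn.
rewrite frac_mul; apply/eqP; rewrite (frac_eq _ _ b0 (mulf_neq0 b0 x0)) Ea.
by apply/eqP; ring.
Qed.

Lemma prime_hypersurface : hypersurface I.
Proof.
split; first exact: generated_closed_subscheme.
move=> W [Wcl Wirr WI Wmax]; have JW : subset_pts (zero_locus J) W.
  apply: Wmax; [exact: zero_locus_closed J_homog|exact: zero_locus_irreducible| |].
    by move=> P /WI/generated_support.
  by move=> P PJ; apply/generated_support.
by apply: zero_locus_codim => // P /WI/generated_support.
Qed.

Lemma prime_integral : integral I.
Proof.
split; last exact: generated_reduced.
have [[P PJ] irr] := zero_locus_irreducible.
split; first by exists P; apply/generated_support.
move=> A B Acl Bcl cover.
case: (irr A B Acl Bcl) => [Q QJ|sub|sub]; first by apply/cover/generated_support.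
  by left=> Q /generated_support/sub.
by right=> Q /generated_support/sub.
Qed.

End PrimeHypersurface.

Local Close Scope ring_scope.

Theorem theorem1p2 (n d p : nat) (hn : 2 <= n) (hd : 2 <= d)
    (hp : prime p) (hp_odd : odd p) (hpd : ~~ (p %| d - 1)) :
  [/\ endomorphism (example_map n d p) d,
      defined_over_rat (example_map n d p),
      hypersurface (critical_ideal (example_map n d p)) &
      integral (critical_ideal (example_map n d p))].
Proof.
have endo := example_endomorphism n hd hp_odd.
have [J [dJ J_homog J0 J_prime]] := jacobian_prime hn hd hp hp_odd hpd.
pose D := (\det (jacobian (tnth (example_map n d p))))%R.
have DE : D = (d%:R * J)%R.
  rewrite dJ /D; congr (\det _)%R; apply/matrixP => a b.
  by rewrite !mxE tnth_mktuple.
have d0 : (d%:R != 0 :> algC)%R by rewrite Num.Theory.pnatr_eq0 -lt0n ltnW.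
have dK : ((d%:R^-1)%:MP * d%:R = 1 :> {mpoly algC[n.+1]})%R.
  by rewrite -mpolyC_nat -mpolyCM mulVf // mpolyC1.
have D_prime : prime_element D by rewrite DE; exact: prime_elementMl dK J_prime.
have D0 : (D != 0)%R.
  by rewrite DE mulf_neq0 // -mpolyC_nat mpolyC_eq0.
have D_homog : D \is (n.+1 * d.-1).-homog.
  by rewrite DE; exact: homog_nat_mul.
have N1 : 1 < n.+1 * d.-1.
  by rewrite (leq_trans hn) // (leq_trans (leqnSn n)) // leq_pmulr // -ltnS prednK // ltnW.
have crit P i : ~ prime_of P ('X_i)%R -> forall s, critical_ideal (example_map n d p) P s <->
    exists a, local_ring P a /\
      s = (a * (FracField.tofrac D / FracField.tofrac ('X_i ^+ (n.+1 * d.-1))))%R.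
  move=> nPi s; have [l nPl] := example_relevant P hd hp_odd.
  exact: (critical_idealP (ltnW hd) d0 endo.1 nPi nPl).
split=> //.
- exact: example_defined_over_rat.
- exact: (prime_hypersurface N1 D0 D_homog D_prime crit).
- exact: (prime_integral N1 D0 D_homog D_prime crit).
Qed.
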